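(* Let $\Omega$ be an infinite compact subset of $\mathbb{R}$, and let $X\subseteq\mathcal{P}_m(\Omega)$ be a subspace with a positive basis and, as such, of maximal possible dimension. Then $$\dim X=\begin{cases} m & \text{if } \frac{m}{2}\le\lambda(\Omega),\\[1ex] m-\Theta_\ell\Theta_r & \text{if } \frac{m-1}{2}=\lambda(\Omega),\\[1ex] \left[\frac{m-\Theta_\ell-\Theta_r}{2}\right]+1+\lambda(\Omega) & \text{if } \frac{m-2}{2}\ge\lambda(\Omega)\ge 1,\\[1ex] \left[\frac{m+3}{2}\right] & \text{if } \lambda(\Omega)=0.\end{cases}$$
   Context: Here $m\in\mathbb{N}$, and $\mathcal{P}_m(\Omega)$ is the space of restrictions to $\Omega$ of real polynomials of degree at most $m$, with the pointwise order; a function is called positive if it is $\ge 0$ at every point of $\Omega$. A positive basis of a finite-dimensional subspace $X\subseteq C(\Omega)$ (the space of real-valued continuous functions on $\Omega$) is a vector space basis of $X$ consisting of positive functions such that every positive element of $X$ is a linear combination of the basis elements with nonnegative coefficients. $[y]$ denotes the integer part of $y$. Let $a=\min\Omega$, $b=\max\Omega$, and write $\mathbb{R}\setminus\Omega=(-\infty,a)\cup(b,\infty)\cup\bigcup_{k\in\mathcal{K}}I_k$, where $(I_k)_{k\in\mathcal{K}}$ are the bounded connected components of $\mathbb{R}\setminus\Omega$ (disjoint open intervals contained in $(a,b)$, called holes). A free family of holes is a family $\{I_\ell:\ell\in\mathcal{L}\}$ with $\mathcal{L}\subseteq\mathcal{K}$ such that $\overline{I_\ell}\cap\overline{I_{\ell'}}=\emptyset$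 for all distinct $\ell,\ell'\in\mathcal{L}$. Then $\lambda(\Omega)\in\{0,1,2,\dots\}\cup\{\infty\}$ is the maximal possible cardinality of a free family of holes ($\infty$ if there is no finite bound). Let $\dot\Omega$ be the set of limit points of $\Omega$. The points of $\Omega\setminus\operatorname{conv}\dot\Omega$ are called eccentric points of $\Omega$. If there are only finitely many of them (which is the case if $\lambda(\Omega)<\infty$), then $\Theta_\ell,\Theta_r\in\{0,1\}$ denote the parity of the number of eccentric points lying to the left, respectively to the right, of $\operatorname{conv}\dot\Omega$.
   Formalization: The first two cases are stated only for m ≥ 2: for m = 1 the functions x − min Ω and max Ω − x give dim X = 2, and for m = 0 constants give dim X = 1, contrary to the printed values; the other two cases are unrestricted. *)

(* Defs.v *)
From HB Require Import structures.
From mathcomp Require Import all_boot all_order all_algebra finmap.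
From mathcomp Require Import all_classical all_reals all_analysis.
Import Order.TTheory GRing.Theory Num.Theory.
Import numFieldNormedType.Exports.

Set Implicit Arguments.
Unset Strict Implicit.
Unset Printing Implicit Defensive.

Local Open Scope classical_set_scope.
Local Open Scope ring_scope.

Section LinearAlgebra.
Variables (R : realType) (V : lmodType R).

Definition is_subspace (X : set V) : Prop :=
  X 0 /\ forall (a : R) (u v : V), X u -> X v -> X (a *: u + v).

Definition is_basis (X : set V) (n : nat) (e : 'I_n -> V) : Prop :=
  [/\ forall i, X (e i),
      forall c : 'I_n -> R, \sum_(i < n) c i *: e i = 0 -> forall i, c i = 0
    & forall f, X f -> exists c : 'I_n -> R, f = \sum_(i < n) c i *: e i].

Definition has_dim (X : set V) (d : nat) : Prop :=
  exists e : 'I_d -> V, is_basis X e.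

End LinearAlgebra.

(* Below, [Omega -> R] is the space of real functions on the subtype of the
   points of Omega, with its pointwise structure. *)

Section PositiveBases.
Variables (R : realType) (Omega : set R).

Definition poly_space (m : nat) : set (Omega -> R) :=
  [set f | exists2 p : {poly R},
             (size p <= m.+1)%N & forall x : Omega, f x = p.[val x]].

Definition positive_fun (f : Omega -> R) : Prop := forall x, 0 <= f x.

Definition positive_basis (X : set (Omega -> R)) (n : nat)
    (e : 'I_n -> (Omega -> R)) : Prop :=
  [/\ is_basis X e,
      forall i, positive_fun (e i)
    & forall f, X f -> positive_fun f ->
        exists2 c : 'I_n -> R,
          (forall i, 0 <= c i) & f = \sum_(i < n) c i *: e i].

Definition has_positive_basis (X : set (Omega -> R)) : Prop :=
  exists (n : nat) (e : 'I_n -> (Omega -> R)), positive_basis X e.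

(* Elements of [poly_space m] are continuous, so a subspace of it is a
   (finite-dimensional) subspace of C(Omega). *)
Definition pos_basis_subspace (m : nat) (X : set (Omega -> R)) : Prop :=
  [/\ is_subspace X, X `<=` poly_space m & has_positive_basis X].

End PositiveBases.

Section Holes.
Variables (R : realType) (Omega : set R).

Definition hole (I : set R) : Prop :=
  bounded_set I /\
  exists2 x, (~` Omega) x & I = connected_component (~` Omega) x.

Definition free_holes (F : set (set R)) : Prop :=
  F `<=` hole /\ trivIset F closure.

(* The set of cardinalities contains 0 (empty family) and consists of natural
   numbers, so the supremum is its maximum if it is bounded, and +oo if not. *)
Definition lambda : \bar R :=
  ereal_sup [set (n%:R : R)%:E | n in
    [set n : nat | exists2 F, free_holes F & (F #= `I_n)%card]].

(* In R the convex hull of a set is its interval hull. *)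
Definition conv_limit_points : set R := [set` Rhull (limit_point Omega)].

Definition eccentric : set R := Omega `\` conv_limit_points.

Definition eccentric_left : set R :=
  [set x | eccentric x /\ forall y, conv_limit_points y -> x < y].

Definition eccentric_right : set R :=
  [set x | eccentric x /\ forall y, conv_limit_points y -> y < x].

(* [fset_set A] is a junk value when A is infinite; both parities are used only
   when lambda is finite, and then [eccentric] is finite. *)
Definition Theta_l : nat := odd #|` fset_set eccentric_left|.
Definition Theta_r : nat := odd #|` fset_set eccentric_right|.

End Holes.

(* Main.v *)
(** If [e_1, ..., e_n] is a positive basis, then for every i and eps > 0 some
    point x of Omega satisfies sum_(j <> i) e_j(x) < eps e_i(x): otherwise
    sum_(j <> i) e_j - eps e_i would be a positive element with a negative
    coefficient. A cluster point t_i of such x is a zero of e_j for all j <> i,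
    of larger order than as a zero of e_i, so the t_i are distinct. Hence n is
    at most the size of a set T in Omega such that every T \ {t} is contained in
    the zeros of a nonzero polynomial of degree <= m that is nonnegative on
    Omega.

    Such a polynomial can have a simple zero at s only if it is negative next to
    s, i.e. s is min Omega, max Omega or an end of a hole in which the polynomial
    changes sign again. Counting zeros from left to right gives
      2 |S| <= m + 2 |l| + [min Omega in S] + [max Omega in S]
    for the zero set S, where l is a family of holes with all ends distinct and
    in S; moreover l may be assumed to avoid min Omega and max Omega when they
    are counted. The optimal t to delete from T is min Omega if Theta_l = 1,
    max Omega if Theta_r = 1, and otherwise the right end of the leftmost hole
    with both ends in T. The parities enter because the isolated points
    x_1 < ... < x_p left of the limit points, followed by the least limit point
    c, are consecutive: a largest such family must use x_1 = min Omega if p is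
    odd, and can avoid it if p is even.

    Conversely, products of the factors (x - u)(x - v) for a hole ]u, v[,
    x - min Omega, max Omega - x and (x - t)^2 give positive bases of the
    required size. *)
Require Import Defs.
From HB Require Import structures.
From mathcomp Require Import all_boot all_order all_algebra finmap.
From mathcomp Require Import all_classical all_reals all_analysis.
From mathcomp Require Import zify ring lra.
Import Order.TTheory GRing.Theory Num.Theory.
Import numFieldNormedType.Exports.

Set Implicit Arguments.
Unset Strict Implicit.
Unset Printing Implicit Defensive.

Local Open Scope classical_set_scope.
Local Open Scope ring_scope.

(** * Zeros of nonnegative polynomials and gaps *)

Section Matchings.
Variables (R : realType) (Om : set R).

Definition gap (u v : R) : Prop :=
  [/\ Om u, Om v, u < v & forall w, Om w -> ~~ (u < w < v)].

Definition ends (l : seq (R * R)) : seq R := flatten [seq [:: e.1; e.2] | e <- l].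

(** Gaps are the edges of the graph of consecutive points of [Om]; families of holes with disjoint
    closures correspond to matchings of this graph. *)
Definition matching (l : seq (R * R)) : Prop :=
  (forall e, e \in l -> gap e.1 e.2) /\ uniq (ends l).

Lemma ends_cat l1 l2 : ends (l1 ++ l2) = ends l1 ++ ends l2.
Proof. by rewrite /ends map_cat flatten_cat. Qed.

Lemma size_ends l : size (ends l) = (size l).*2.
Proof. by elim: l => //= e l ->; rewrite doubleS. Qed.

Lemma endsP l x : reflect (exists2 e, e \in l & x = e.1 \/ x = e.2) (x \in ends l).
Proof.
apply: (iffP flatten_mapP) => -[e el xe]; exists e => //.
  by move: xe; rewrite !inE => /orP[]/eqP; [left|right].
by rewrite !inE; case: xe => ->; rewrite eqxx ?orbT.
Qed.

Lemma matching_cat l1 l2 : matching l1 -> matching l2 ->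
  (forall x, x \in ends l1 -> x \notin ends l2) -> matching (l1 ++ l2).
Proof.
move=> [g1 u1] [g2 u2] d; split=> [e|].
  by rewrite mem_cat => /orP[/g1|/g2].
rewrite ends_cat cat_uniq u1 u2 andbT /=; apply/hasPn => x x2.
by apply/negP => /d; rewrite x2.
Qed.

Lemma subseq_matching l1 l2 : subseq l1 l2 -> matching l2 -> matching l1.
Proof.
move=> s [g u]; split=> [e /(mem_subseq s)/g//|].
suff : subseq (ends l1) (ends l2) by move=> /subseq_uniq; apply.
elim: l2 l1 s {g u} => [|e l2 IH] [|e1 l1] //.
rewrite [X in X -> _]/=; case: eqP => [->|_] /IH h; first by rewrite /= !eqxx.
by apply: (subseq_trans h); rewrite -[ends (e :: l2)]/([:: e.1; e.2] ++ ends l2) suffix_subseq.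
Qed.

Lemma matching_consE e l : matching (e :: l) <->
  [/\ gap e.1 e.2, matching l, e.1 \notin ends l & e.2 \notin ends l].
Proof.
split=> [[g /= /and3P[]]|[g [gl ul] n1 n2]].
  rewrite inE negb_or => /andP[_ n1] n2 u; split => //.
    by apply: g; rewrite inE eqxx.
  by split=> // e' e'l; apply: g; rewrite inE e'l orbT.
split=> [e'|/=]; first by rewrite inE => /orP[/eqP->|/gl].
rewrite inE negb_or n1 n2 andbT; apply/andP; split=> //.
by case: g => _ _ h _; rewrite lt_eqF.
Qed.

(** * Counting roots with multiplicity from right to left *)

Section Scan.
Variables (a b : R).
Hypotheses (aOm : Om a) (a_min : forall x, Om x -> a <= x).
Hypotheses (bOm : Om b) (b_max : forall x, Om x -> x <= b).
Variables (rs : seq R) (neg0 : bool).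

(* [neg x]: a polynomial with real roots [rs], counted with multiplicity, is
   negative immediately to the right of [x]; [neg0] is its sign at +oo. *)
Let neg (x : R) := neg0 (+) odd (count (> x) rs).

Hypothesis neg_Om : forall v, Om v -> v \notin rs -> ~~ neg v.

Let cnt (x y : R) := count (fun z => x < z <= y) rs.

Let count_gt x y : x <= y -> count (> x) rs = (cnt x y + count (> y) rs)%N.
Proof.
move=> xy; rewrite /cnt; elim: rs => //= z s ->; rewrite !addnA.
rewrite (ltNge y z); case: (lerP z y) => zy; case: (ltrP x z) => xz /=; try lia.
by move: (lt_le_trans zy (le_trans xz xy)); rewrite ltxx.
Qed.

Let cnt_gt0 x y z : z \in rs -> x < z <= y -> (0 < cnt x y)%N.
Proof. by move=> zrs h; rewrite -has_count; apply/hasP; exists z. Qed.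

Let negE x y : x <= y -> neg x = neg y (+) odd (cnt x y).
Proof. by move=> /count_gt xy; rewrite /neg xy oddD addbA addbAC. Qed.

(** Either [v] is itself a root, or the sign is not negative at [v] and must have changed on the way
    from [x]. *)
Let neg_cnt x v : neg x -> x < v -> Om v -> (0 < cnt x v)%N.
Proof.
move=> nx xv Ov; have [vrs|vrs] := boolP (v \in rs).
  by apply: (@cnt_gt0 _ _ v) => //; rewrite xv lexx.
move: nx; rewrite (negE (ltW xv)) (negbTE (neg_Om Ov vrs)) /=.
exact: odd_gt0.
Qed.

Let cntD x y z : x <= y -> y <= z -> cnt x z = (cnt x y + cnt y z)%N.
Proof.
move=> xy yz; apply/eqP; rewrite -(eqn_add2r (count (> z) rs)) -addnA.
by rewrite -!count_gt //; apply: le_trans yz.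
Qed.

(* Scanning [s] from its right end to [x]: every point of [s] needs two roots,
   except that a gap whose ends are both in [s], or [b], can save simple ones. *)
Lemma scan x s : Om x -> path <%R x s -> (forall y, y \in s -> Om y) ->
    {subset s <= rs} ->
  exists l (bb : bool),
    [/\ matching l, {subset ends l <= x :: s}, (~~ neg x -> x \notin ends l),
        (bb -> [/\ b \notin ends l, b \in x :: s & (b == x -> neg x)])
      & ((size s).*2 + neg x <= count (> x) rs + (size l).*2 + bb)%N].
Proof.
elim: s x => [|y s IH] x Ox.
  (* If the sign is negative after [x], a root in []x, b]] pays for it, unless [x] is [b], which is
     then the extreme point that saves a root. *)
  move=> _ _ _; exists [::], ((x == b) && neg x); split=> //.
  by move=> /andP[/eqP xb nx]; split=> //; rewrite inE xb eqxx.
  rewrite /= double0 add0n addn0; case: (boolP (neg x)) => // nx.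
  case: eqP => [_|/eqP xb] /=; first by rewrite addn1.
  have {}xb : x < b by rewrite lt_neqAle xb b_max.
  by have := neg_cnt nx xb bOm; rewrite (count_gt (ltW xb)); lia.
move=> /= /andP[xy ys] Os sub.
have Oy : Om y by apply: Os; rewrite inE eqxx.
have yrs : y \in rs by apply: sub; rewrite inE eqxx.
have [z zs|z zs|l [bb [ml el nl bl hl]]] := IH y Oy ys.
- by apply: Os; rewrite inE zs orbT.
- by apply: sub; rewrite inE zs orbT.
have cxy : (0 < cnt x y)%N by apply: (@cnt_gt0 _ _ y) => //; rewrite xy lexx.
have xl : x \notin ends l.
  apply/negP => /el; rewrite inE => /orP[/eqP xy'|xs].
    by move: xy; rewrite xy' ltxx.
  move: ys; rewrite (path_sortedE lt_trans) => /andP[/allP/(_ _ xs) /= yx _].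
  by move: (lt_trans xy yx); rewrite ltxx.
have el' : {subset ends l <= x :: y :: s}.
  by move=> z /el; rewrite !inE => ->; rewrite orbT.
have bx : (b == x) = false by rewrite gt_eqF// (lt_le_trans xy)// b_max.
have Hb : bb -> [/\ b \notin ends l, b \in x :: y :: s & (b == x -> neg x)].
  by move=> /bl[-> bys _]; split=> //; rewrite ?bx// inE bys orbT.
have nE := negE (ltW xy); have cE := count_gt (ltW xy).
move: cxy hl cE nE; set N := count (> y) rs; set k := cnt x y => cxy hl cE nE.
have kE := odd_double_half k.
(* If [neg y] holds, one root is already paid for. The positive number [k] has the parity of
   [1 + neg x], hence [k >= 1 + neg x], and [l] is kept. *)
have [ny|ny] := boolP (neg y); rewrite ?ny ?(negbTE ny) /= in hl nE.
  exists l, bb; split=> //; rewrite nE cE [size _]/=; 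
  by move: kE hl cxy; clear -neg; clearbody k N; case: (odd k); lia.
have {}nl := nl ny.
(* Now [k] has the parity of [neg x]. If it is even, it is at least 2, which is enough for [y]. *)
case: (boolP (neg x)) Hb nE => nx Hb nE; last first.
  exists l, bb; split=> //; rewrite cE [size _]/=.
  by move: nE kE cxy hl; clear -neg; clearbody k N; case: (odd k) => // _; lia.
(* Now [k] is odd and three roots are called for. If [x], [y] is a gap, adding it to [l] makes up
   for two of them; [y] is free because [neg y] fails. *)
have [gxy|ngxy] := pselect (gap x y).
  exists ((x, y) :: l), bb; split=> //.
  - by apply/matching_consE; split.
  - move=> z; rewrite inE => /orP[/eqP->|]; rewrite ?inE ?eqxx//.
    by move=> /orP[/eqP->|/el']; rewrite ?inE ?eqxx ?orbT.
  - move=> bbT; have [bl1 bs _] := Hb bbT; split; rewrite ?bx//.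
    have [_ _ by_] := bl bbT.
    rewrite -[ends _]/(x :: y :: ends l) !inE (negbTE bl1) bx orbF /=.
    by apply/negP => /by_; rewrite (negbTE ny).
  - by rewrite cE /=; move: hl cxy; clear -neg; clearbody k N; lia.
have [v Ov /andP[xv vy]] : exists2 v, Om v & x < v < y.
  by apply: contrapT => nv; apply: ngxy; split => // w Ow; apply/negP => wv; apply: nv; exists w.
exists l, bb; split => //.
(* A point [v] strictly between forces a root in []x, v]] besides the root [y], so the odd number
   [k] is at least 3. *)
have c1 := neg_cnt nx xv Ov.
have c2 : (0 < cnt v y)%N by apply: (@cnt_gt0 _ _ y) => //; rewrite vy lexx.
have kD : k = (cnt x v + cnt v y)%N by apply: cntD; exact: ltW.
rewrite cE [size _]/=; move: nE kE hl c1 c2 kD; clear -neg; clearbody k N; move: (cnt x v) (cnt v y) => k1 k2.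
by case: (odd k) => // _; lia.
Qed.

(** The scan is used at the leftmost point [y] of [s]. It remains to find two roots in []-oo, y]],
    or only one if [neg y] holds or [y] is [a]. *)
Lemma matching_bound s : sorted <%R s -> (forall y, y \in s -> Om y) ->
    {subset s <= rs} ->
  exists l (ba bb : bool),
    [/\ matching l, {subset ends l <= s}, (ba -> a \notin ends l /\ a \in s),
        (bb -> b \notin ends l /\ b \in s)
      & ((size s).*2 <= size rs + (size l).*2 + ba + bb)%N].
Proof.
case: s => [|y s]; first by move=> *; exists [::], false, false; split.
move=> /= ys Os sub.
have Oy : Om y by apply: Os; rewrite inE eqxx.
have yrs : y \in rs by apply: sub; rewrite inE eqxx.
have [z zs|z zs|l [bb [ml el nl bl hl]]] := scan Oy ys.
- by apply: Os; rewrite inE zs orbT.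
- by apply: sub; rewrite inE zs orbT.
set N := count (> y) rs in hl.
have kE : size rs = (count (<= y) rs + N)%N.
  rewrite /N -(count_predC (<= y)) addnC [RHS]addnC; congr (_ + _)%N.
  by apply: eq_count => z /=; rewrite -ltNge.
have k0 : (0 < count (<= y) rs)%N by rewrite -has_count; apply/hasP; exists y => /=.
exists l, ((a == y) && ~~ neg y), bb; split => //.
- by move=> /andP[/eqP-> /nl]; rewrite mem_head.
- by move=> /bl[].
(* Either [a] is a second root, or the sign is not negative at [a] and the number of roots in []a,
   y]] is even. *)
have k1 : ~~ neg y -> a != y -> (1 < count (<= y) rs)%N.
  move=> ny ay; have {}ay : a < y by rewrite lt_neqAle ay a_min.
  have kD : count (<= y) rs = (count (<= a) rs + cnt a y)%N.
    rewrite /cnt; elim: (rs) => //= z r ->; rewrite addnACA; congr (_ + _)%N.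
    rewrite ltNge; case: (leP z a) => //= za.
    by rewrite (le_trans za (ltW ay)).
  have c0 : (0 < cnt a y)%N by apply: (@cnt_gt0 _ _ y) => //; rewrite ay lexx.
  rewrite kD; have [ars|ars] := boolP (a \in rs).
    have : (0 < count (<= a) rs)%N by rewrite -has_count; apply/hasP; exists a => /=.
    by move: c0; clear -neg; lia.
  have := neg_Om aOm ars; rewrite (negE (ltW ay)) (negbTE ny) /= => odd0.
  by have := odd_double_half (cnt a y); rewrite (negbTE odd0); move: c0; clear -neg; lia.
move: hl kE k0 k1; clearbody N; move: (count (<= y) rs) => k hl -> /=.
case: (boolP (neg y)) hl => ny hl k0 k1 /=; first by rewrite andbF; move: hl k0 => /=; clear -neg; lia.
rewrite andbT; case: eqP k1 => [_ _|/eqP ay /(_ isT isT)] /=; move: hl k0 => /=; clear -neg; lia.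
Qed.
End Scan.
End Matchings.

(** * Holes *)

Section RealSets.
Variable R : realType.
Implicit Types (A Om : set R) (u v x : R).

Lemma bounded_setE A : bounded_set A -> exists M : R, forall x, A x -> `|x| <= M.
Proof.
by move=> [M [_ AM]]; exists (M + 1) => x Ax; apply: (AM (M + 1)) => //; rewrite ltrDl.
Qed.

Lemma nbhs_norm_lt x (U : set R) : nbhs x U ->
  exists2 e : R, 0 < e & forall y, `|y - x| < e -> U y.
Proof.
move=> /nbhs_ballP[e /= e0 eU]; exists e => // y yx; apply: eU.
by rewrite -ball_normE /= distrC.
Qed.

Lemma closed_min A : closed A -> A !=set0 -> (exists M : R, forall x, A x -> M <= x) ->
  exists2 x, A x & forall y, A y -> x <= y.
Proof.
move=> cA A0 [M AM].
have lA : has_inf A by split=> //; exists M => x /AM.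
exists (inf A); last by move=> y Ay; apply: ge_inf => //; case: lA.
apply: cA => U /nbhs_norm_lt[e e0 eU].
have [y Ay ye] := inf_adherent e0 lA.
exists y; split=> //; apply: eU.
rewrite ger0_norm ?subr_ge0; last by apply: ge_inf => //; case: lA.
by rewrite ltrBlDl.
Qed.

Lemma closed_opp A : closed A -> closed (-%R @` A).
Proof.
have -> : -%R @` A = -%R @^-1` A.
  by apply/seteqP; split=> [_ [x Ax <-]|x Ax] /=; rewrite ?opprK//; exists (- x); rewrite ?opprK.
by apply: preimage_closed => x _; exact: opp_continuous.
Qed.

Lemma closed_max A : closed A -> A !=set0 -> (exists M : R, forall x, A x -> x <= M) ->
  exists2 x, A x & forall y, A y -> y <= x.
Proof.
move=> cA [x Ax] [M AM].
have [] := closed_min (closed_opp cA).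
- by exists (- x), x.
- by exists (- M) => _ [y /AM yM <-]; rewrite lerN2.
move=> _ [y Ay <-] yA; exists y => // z Az.
by rewrite -lerN2; apply: yA; exists z.
Qed.

Lemma compact_bounds A : compact A -> A !=set0 ->
  exists a b, [/\ A a, A b, forall x, A x -> a <= x & forall x, A x -> x <= b].
Proof.
move=> cA A0; have clA := compact_closed (@norm_hausdorff _ _) cA.
have [M AM] := bounded_setE (compact_bounded cA).
have [a Aa aA] : exists2 x, A x & forall y, A y -> x <= y.
  by apply: closed_min => //; exists (- M) => x /AM; rewrite ler_norml => /andP[].
have [b Ab bA] : exists2 x, A x & forall y, A y -> y <= x.
  by apply: closed_max => //; exists M => x /AM; rewrite ler_norml => /andP[].
by exists a, b; split.
Qed.

Lemma gap_component Om u v x : gap Om u v -> u < x < v ->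
  connected_component (~` Om) x = `]u, v[%classic.
Proof.
move=> [Ou Ov uv nuv] /andP[ux xv]; apply/seteqP; split=> [y [C [Cx CA]]|].
  move=> /connected_intervalP iC Cy; rewrite /= in_itv /=; apply/andP; split.
    by rewrite ltNge; apply/negP => yu; apply: (CA u) => //; apply: (iC y x) => //; rewrite yu ltW.
  by rewrite ltNge; apply/negP => vy; apply: (CA v) => //; apply: (iC x y) => //; rewrite vy ltW.
apply: connected_component_max.
- by rewrite /= in_itv /= ux xv.
- by move=> y /=; rewrite in_itv /= => uyv /nuv; rewrite uyv.
- exact/connected_intervalP/interval_is_interval.
Qed.

Lemma gap_hole Om u v : gap Om u v -> hole Om `]u, v[%classic.
Proof.
move=> g; have [Ou Ov uv nuv] := g; split.
  exists (`|u| + `|v|); split=> [|M /= hM y]; first exact: num_real.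
  rewrite /= in_itv /= => /andP[uy yv]; apply: le_trans (ltW hM).
  have h1 := ler_norm v; have h2 : - `|u| <= u by rewrite lerNl -normrN ler_norm.
  have h3 := normr_ge0 u; have h4 := normr_ge0 v.
  by rewrite ler_norml; apply/andP; split; lra.
have muv : u < (u + v) / 2 < v by apply/andP; split; lra.
exists ((u + v) / 2); last by rewrite (@gap_component _ u v).
by move=> /nuv; rewrite muv.
Qed.

(** Without a point of [Om] on one side of [x], the component would contain a half-line, although a
    hole is bounded. The ends are the points of [Om] nearest to [x], which exist as [Om] is
    closed. *)
Lemma hole_gap Om (I : set R) : closed Om -> hole Om I ->
  exists e : R * R, gap Om e.1 e.2 /\ I = `]e.1, e.2[%classic.
Proof.
move=> cO [/bounded_setE[M IM] [x nOx IE]].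
have [w Ow wx] : exists2 w, Om w & w < x.
  apply: contrapT => nw.
  have Isub : [set y | y <= x] `<=` I.
    rewrite IE; apply: connected_component_max => /=; first exact: lexx.
      move=> y /= yx Oy; apply: nw; exists y => //; rewrite lt_neqAle yx andbT.
      by apply/eqP => xy; apply: nOx; rewrite -xy.
    apply/connected_intervalP => y z /= yx zx t /andP[_ tz]; exact: le_trans zx.
  have p0 : 0 <= `|x| + `|M| + 1 by rewrite !addr_ge0.
  have := IM (- (`|x| + `|M| + 1)) (Isub _ _).
  rewrite /= normrN (ger0_norm p0).
  have := ler_norm M; have : - `|x| <= x by rewrite lerNl -normrN ler_norm.
  have := normr_ge0 M; have := normr_ge0 x => h1 h2 h3 h4 h5.
  have /h5 h6 : - (`|x| + `|M| + 1) <= x by lra.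
  have : (0 : R) < 0 by lra.
  by rewrite ltxx.
have [w' Ow' xw'] : exists2 w, Om w & x < w.
  apply: contrapT => nw.
  have Isub : [set y | x <= y] `<=` I.
    rewrite IE; apply: connected_component_max => /=; first exact: lexx.
      move=> y /= yx Oy; apply: nw; exists y => //; rewrite lt_neqAle yx andbT.
      by apply/eqP => xy; apply: nOx; rewrite xy.
    apply/connected_intervalP => y z /= yx zx t /andP[yt _]; exact: le_trans yt.
  have p0 : 0 <= `|x| + `|M| + 1 by rewrite !addr_ge0.
  have := IM (`|x| + `|M| + 1) (Isub _ _).
  rewrite /= (ger0_norm p0).
  have := ler_norm M; have := ler_norm x.
  have := normr_ge0 M; have := normr_ge0 x => h1 h2 h3 h4 h5.
  have /h5 h6 : x <= `|x| + `|M| + 1 by lra.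
  have : (0 : R) < 0 by lra.
  by rewrite ltxx.
have [u [Ou ux] uA] : exists2 u, (Om `&` [set y | y <= x]) u &
    forall y, (Om `&` [set y | y <= x]) y -> y <= u.
  apply: closed_max; first by apply: closedI => //; exact: closed_le.
    by exists w; split => //=; exact: ltW.
  by exists x => y [].
have [v [Ov vx] vA] : exists2 u, (Om `&` [set y | x <= y]) u &
    forall y, (Om `&` [set y | x <= y]) y -> u <= y.
  apply: closed_min; first by apply: closedI => //; exact: closed_ge.
    by exists w'; split => //=; exact: ltW.
  by exists x => y [].
have {}ux : u < x.
  by rewrite lt_neqAle ux andbT; apply/eqP => uxE; apply: nOx; rewrite -uxE.
have {}vx : x < v.
  by rewrite lt_neqAle vx andbT; apply/eqP => uxE; apply: nOx; rewrite uxE.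
have guv : gap Om u v.
  split=> // [|y Oy]; first exact: lt_trans vx.
  apply/negP => /andP[uy yv]; have [yx|xy] := leP y x.
    by move: uy; rewrite ltNge uA.
  by move: yv; rewrite ltNge vA //; split=> //=; exact: ltW.
by exists (u, v); split=> //=; rewrite IE (@gap_component _ u v)// ux vx.
Qed.

Lemma closure_oo_l u v : u < v -> closure `]u, v[ u.
Proof.
move=> uv U /nbhs_norm_lt[e e0 eU].
have m0 : 0 < Num.min e (v - u) by rewrite lt_min e0 subr_gt0.
have me : Num.min e (v - u) <= e by rewrite ge_min lexx.
have mv : Num.min e (v - u) <= v - u by rewrite ge_min lexx orbT.
exists (u + Num.min e (v - u) / 2); split.
  by rewrite /= in_itv /=; apply/andP; split; lra.
by apply: eU; rewrite addrAC subrr add0r ger0_norm; lra.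
Qed.

Lemma closure_oo_r u v : u < v -> closure `]u, v[ v.
Proof.
move=> uv U /nbhs_norm_lt[e e0 eU].
have m0 : 0 < Num.min e (v - u) by rewrite lt_min e0 subr_gt0.
have me : Num.min e (v - u) <= e by rewrite ge_min lexx.
have mv : Num.min e (v - u) <= v - u by rewrite ge_min lexx orbT.
exists (v - Num.min e (v - u) / 2); split.
  by rewrite /= in_itv /=; apply/andP; split; lra.
by apply: eU; rewrite addrAC subrr add0r normrN ger0_norm; lra.
Qed.

Lemma closure_oo_sub u v x : closure `]u, v[ x -> u <= x <= v.
Proof.
move=> cx; suff : `[u, v]%classic x by rewrite /= in_itv.
rewrite ((closure_id `[u, v]%classic).1 (@itv_closed _ _ u v)).
by apply: closure_subset cx; exact: subset_itv_oo_cc.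
Qed.

End RealSets.

(** * Free families of holes as matchings of gaps *)

Section Lambda.
Variables (R : realType) (Om : set R).
Hypothesis Om_closed : closed Om.

Definition has_matching (k : nat) : Prop :=
  exists2 l : seq (R * R), matching Om l & size l = k.

Lemma has_matching_le j k : (j <= k)%N -> has_matching k -> has_matching j.
Proof.
move=> jk [l ml lk]; exists (take j l); last by rewrite size_takel// lk.
exact: subseq_matching (take_subseq _ _) ml.
Qed.

(** Closed gaps that meet share an end, there being no point of [Om] inside a gap; in a matching
    only one gap has a given end. *)
Lemma matching_oo_inj l e e' : matching Om l -> e \in l -> e' \in l ->
  closure `]e.1, e.2[%classic `&` closure `]e'.1, e'.2[%classic !=set0 -> e = e'.
Proof.
move=> [gl ul] el e'l [x [/closure_oo_sub x1 /closure_oo_sub x2]].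
have [Ou Ov uv nuv] := gl _ el; have [Ou' Ov' uv' nuv'] := gl _ e'l.
have shared : [|| e.1 == e'.1, e.1 == e'.2, e.2 == e'.1 | e.2 == e'.2].
  move: x1 x2 => /andP[ux xv] /andP[ux' xv'].
  case: (ltgtP e.1 e'.1) => //= uu.
    have := nuv _ Ou'; rewrite uu /= -leNgt => vu.
    by rewrite (@le_anti _ _ e.2 e'.1) ?eqxx ?orbT// vu (le_trans ux').
  have := nuv' _ Ou; rewrite uu /= -leNgt => vu.
  by rewrite (@le_anti _ _ e.1 e'.2) ?eqxx// vu (le_trans ux).
elim: l ul {gl} el e'l => // e0 l IH /and3P[n1 n2 u].
have n3 x0 : x0 \in [:: e0.1; e0.2] -> x0 \notin ends l.
  by move: n1 n2; rewrite !inE negb_or => /andP[_ h] h' /orP[]/eqP->.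
rewrite !inE => /orP[/eqP e0E|el] /orP[/eqP e0E'|e'l]; rewrite ?e0E ?e0E'//; last exact: IH.
- move: shared; rewrite e0E => /or4P[]/eqP sE; exfalso.
  + by have := n3 e0.1; rewrite !inE eqxx => /(_ isT)/negP; apply; apply/endsP; exists e'; [|left].
  + by have := n3 e0.1; rewrite !inE eqxx => /(_ isT)/negP; apply; apply/endsP; exists e'; [|right].
  + by have := n3 e0.2; rewrite !inE eqxx orbT => /(_ isT)/negP; apply; apply/endsP; exists e'; [|left].
  + by have := n3 e0.2; rewrite !inE eqxx orbT => /(_ isT)/negP; apply; apply/endsP; exists e'; [|right].
- move: shared; rewrite e0E' => /or4P[]/eqP sE; exfalso.
  + by have := n3 e0.1; rewrite !inE eqxx => /(_ isT)/negP; apply; apply/endsP; exists e; [|left].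
  + by have := n3 e0.2; rewrite !inE eqxx orbT => /(_ isT)/negP; apply; apply/endsP; exists e; [|left].
  + by have := n3 e0.1; rewrite !inE eqxx => /(_ isT)/negP; apply; apply/endsP; exists e; [|right].
  + by have := n3 e0.2; rewrite !inE eqxx orbT => /(_ isT)/negP; apply; apply/endsP; exists e; [|right].
Qed.

Lemma has_matching_lambda k : has_matching k -> ((k%:R)%:E <= lambda Om)%E.
Proof.
move=> [l ml <-{k}]; apply: ereal_sup_ubound => /=; exists (size l) => //.
have [gl ul] := ml.
have nthE i : (i < size l)%N -> nth (0, 0) l i \in l by exact: mem_nth.
exists ((fun i => `](nth (0, 0) l i).1, (nth (0, 0) l i).2[%classic) @` `I_(size l)).
  split=> [_ [i /nthE/gl/gap_hole h <-] //|].
  move=> _ _ [i /nthE il <-] [j /nthE jl <-] h.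
  by rewrite (matching_oo_inj ml il jl h).
apply: inj_card_eq => i j; rewrite !inE /= => il jl ijE.
have [_ _ uv _] := gl _ (nthE _ il).
have ij : nth (0, 0) l i = nth (0, 0) l j.
  apply: (matching_oo_inj ml (nthE _ il) (nthE _ jl)).
  by rewrite -ijE setIid; exists (nth (0, 0) l i).1; exact: closure_oo_l.
apply/eqP; rewrite -(nth_uniq (0, 0) il jl) ?ij//.
elim: (l) ul {il jl ijE uv ij ml gl nthE} => // e s IH /and3P[n1 n2 /IH us] /=.
rewrite us andbT; apply: contra n2 => es; rewrite -/(ends s).
by apply/endsP; exists e => //; right.
Qed.

(** A common end of two holes of the family would lie in the closures of both. *)
Lemma free_holes_matching k F : free_holes Om F -> (F #= `I_k)%card ->
  has_matching k.
Proof.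
move=> [Fh Ft]; rewrite card_eq_sym => /card_set_bijP[f [fF finj _]].
have /boolp.choice[e eP] : forall i, exists e : R * R, (i < k)%N ->
    gap Om e.1 e.2 /\ f i = `]e.1, e.2[%classic.
  move=> i; have [ik|ik] := ltnP i k; last by exists (0, 0).
  by have [e he] := hole_gap Om_closed (Fh _ (fF _ ik)); exists e.
exists (map e (iota 0 k)); last by rewrite size_map size_iota.
have sep i j x : (i < k)%N -> (j < k)%N -> x = (e i).1 \/ x = (e i).2 ->
    x = (e j).1 \/ x = (e j).2 -> i = j.
  move=> ik jk xi xj; apply: finj; rewrite ?inE//.
  apply: Ft; [exact: fF|exact: fF|].
  have [[_ _ uv _] ->] := eP _ ik; have [[_ _ uv' _] ->] := eP _ jk.
  exists x; split.
    by case: xi => ->; [exact: closure_oo_l|exact: closure_oo_r].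
  by case: xj => ->; [exact: closure_oo_l|exact: closure_oo_r].
elim: {-2}k (leqnn k) => // n IH nk.
rewrite -[in X in iota 0 X]addn1 iotaD add0n map_cat; apply: matching_cat.
- exact/IH/ltnW.
- have [[? ? uv ?] _] := eP _ nk.
  by split=> [e0|/=]; rewrite inE ?andbT ?lt_eqF// => /eqP->; split.
- move=> x /endsP[e0 /mapP[i]]; rewrite mem_iota => /= in_ -> xi.
  apply/negP; rewrite /ends /= !inE => /orP xn.
  have xn' : x = (e n).1 \/ x = (e n).2 by case: xn => /eqP->; [left|right].
  by move: (in_); rewrite (sep i n x (ltn_trans in_ nk) nk xi xn') ltnn.
Qed.

(** This replaces the supremum defining [lambda] by the existence of matchings, on which the
    counting arguments work. Matchings can be shortened, so the possible sizes form an initial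
    segment. *)
Lemma lambdaP :
  (lambda Om = +oo%E /\ forall k, has_matching k) \/
  exists r, [/\ lambda Om = (r%:R)%:E, has_matching r & ~ has_matching r.+1].
Proof.
have [all|] := pselect (forall k, has_matching k).
  left; split=> //.
  have := fun k => has_matching_lambda (all k); case: (lambda Om) => [x| |] h //.
    by have := h (Num.truncn x).+1; rewrite lee_fin leNgt truncnS_gt.
  by have := h 0.
move=> /existsNP[k nk]; right.
have ex : exists k, `[< ~ has_matching k >] by exists k; apply/asboolP.
case: (ex_minnP ex) => -[|r] /asboolP nr rmin.
  by exfalso; apply: nr; exists [::].
have mr : has_matching r.
  by apply: contrapT => h; have := rmin r; rewrite ltnn; move/(_ (asboolT h)).
exists r; split => //; apply/eqP; rewrite eq_le has_matching_lambda// andbT.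
apply: ge_ereal_sup => _ [n [F fF Fn] <-]; rewrite lee_fin ler_nat leqNgt.
apply/negP => rn; apply: nr; apply: (@has_matching_le _ n) => //.
exact: free_holes_matching fF Fn.
Qed.
End Lambda.

(** * Eccentric points *)

Section Chains.
Variables (R : realType) (Om : set R).

Definition gapb (u v : R) : bool := `[< gap Om u v >].

Fixpoint pairs (s : seq R) : seq (R * R) :=
  if s is x :: y :: s' then (x, y) :: pairs s' else [::].

Lemma seq_pair_ind (T : Type) (P : seq T -> Prop) : P [::] -> (forall x, P [:: x]) ->
  (forall x y s, P s -> P (x :: y :: s)) -> forall s, P s.
Proof.
move=> P0 P1 P2 s; suff : P s /\ forall x, P (x :: s) by case.
by elim: s => [|y s [IH1 IH2]]; split=> // x; exact: P2.
Qed.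

Lemma size_pairs s : size (pairs s) = (size s)./2.
Proof. by elim/seq_pair_ind: s => //= x y s ->. Qed.

Lemma ends_pairs_subseq s : subseq (ends (pairs s)) s.
Proof.
elim/seq_pair_ind: s => // x y s IH.
by rewrite -[ends _]/(x :: y :: ends (pairs s)) /= !eqxx.
Qed.

Lemma gapb_lt s : sorted gapb s -> sorted <%R s.
Proof. by apply: sub_sorted => u v /asboolP[]. Qed.

Lemma matching_pairs s : sorted gapb s -> matching Om (pairs s).
Proof.
move=> ss; split; last first.
  apply: subseq_uniq (ends_pairs_subseq s) _.
  exact: sorted_uniq lt_trans (@ltxx _ _) _ (gapb_lt ss).
elim/seq_pair_ind: s ss => // x y s IH /= /andP[/asboolP gxy ys] e.
by rewrite inE => /orP[/eqP->//|]; apply: IH; exact: path_sorted ys.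
Qed.

(* [xs] lists the eccentric points on the left, [c] is the least limit point. *)
Definition chain (xs : seq R) (c : R) : Prop :=
  [/\ sorted gapb (rcons xs c), forall x, Om x -> x <= c -> x \in rcons xs c,
      forall v, ~ gap Om c v & exists2 w, Om w & c < w].

Lemma chain_mem xs c x : chain xs c -> Om c -> (x \in xs) <-> (Om x /\ x < c).
Proof.
move=> [ss all_ _ _] Oc; split=> [xxs|[Ox xc]]; last first.
  by have := all_ x Ox (ltW xc); rewrite mem_rcons inE lt_eqF.
split.
  elim: xs {all_} ss xxs => //= y xs IH ss; rewrite inE => /orP[/eqP->|]; last first.
    by apply: IH; exact: path_sorted ss.
  by case: xs ss {IH} => [|z xs] /= /andP[/asboolP[]].
have : sorted (fun x y => y < x) (rev (rcons xs c)) by rewrite rev_sorted; exact: gapb_lt.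
rewrite rev_rcons /= path_sortedE; last by move=> u v w /[swap] /lt_trans; apply.
by move=> /andP[/allP/(_ x) + _]; rewrite mem_rev => /(_ xxs).
Qed.

Lemma limit_point_near c e : limit_point Om c -> 0 < e ->
  exists2 w, Om w & w != c /\ `|w - c| < e.
Proof.
move=> /(_ [set y | `|y - c| < e]) h e0; case: h => [|w [wc Ow we]].
  by apply/nbhs_ballP; exists e => // y; rewrite -ball_normE /= distrC.
by exists w.
Qed.

Hypothesis Om_compact : compact Om.
Variables (a c : R).
Hypotheses (aOm : Om a) (a_min : forall x, Om x -> a <= x).
Hypotheses (c_lim : limit_point Om c) (c_min : forall x, limit_point Om x -> c <= x).

Let Om_closed : closed Om.
Proof. exact: compact_closed (@norm_hausdorff _ _) Om_compact. Qed.

Let cOm : Om c.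
Proof. exact/Om_closed/subset_limit_point. Qed.

(** [x] lies to the left of all limit points, hence is isolated, and the points of [Om] to its right
    form a closed set with a least element. *)
Lemma gap_succ x : Om x -> x < c -> exists2 y, gap Om x y & y <= c.
Proof.
move=> Ox xc.
have [e e0 eP] : exists2 e : R, 0 < e & forall w, Om w -> x < w -> x + e <= w.
  apply: contrapT => ne; suff /c_min : limit_point Om x by rewrite leNgt xc.
  move=> U nU; have [e e0 eU] := nbhs_norm_lt nU; apply: contrapT => nw; apply: ne.
  exists e => // w Ow xw; rewrite leNgt; apply/negP => we; apply: nw.
  exists w; split=> //; first by rewrite gt_eqF.
  by apply: eU; rewrite ger0_norm ?subr_ge0 ?ltW// ltrBlDl.
have [y [Oy xy] yP] : exists2 y, (Om `&` [set z | x + e <= z]) y &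
    forall z, (Om `&` [set z | x + e <= z]) z -> y <= z.
  apply: closed_min; first by apply: closedI => //; exact: closed_ge.
    by exists c; split=> //=; exact: eP.
  by exists (x + e) => z [].
exists y; last by apply: yP; split=> //=; exact: eP.
split=> //; first by apply: lt_le_trans xy; rewrite ltrDl.
move=> w Ow; apply/negP => /andP[xw]; rewrite ltNge => /negP; apply.
by apply: yP; split=> //=; exact: eP.
Qed.

(** The successor is iterated from [a] until [c] is reached. *)
Lemma chain_exists k : ~ has_matching Om k -> exists xs, chain xs c.
Proof.
move=> nk.
have /boolp.choice[s sP] : forall x, exists y, Om x -> x < c -> gap Om x y /\ y <= c.
  move=> x; have [[Ox xc]|h] := pselect (Om x /\ x < c).
    by have [y] := gap_succ Ox xc; exists y.
  by exists 0 => Ox xc; exfalso; apply: h.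
have traj N x : Om x -> (forall i, (i < N)%N -> iter i s x < c) ->
    sorted gapb (traject s x N.+1) /\ Om (iter N s x).
  elim: N x => // N IH x Ox ic.
  have [gx _] := sP x Ox (ic 0%N isT); have [_ Os _ _] := gx.
  have [|sN ON] := IH (s x) Os; first by move=> i iN; rewrite -iterSr; exact: ic.
  by rewrite iterSr; split=> //=; apply/andP; split=> //; apply/asboolP.
(* [2 k] steps without reaching [c] would pair off into a matching of size [k]. *)
have ex : exists n, c <= iter n s a.
  apply: contrapT => nn; apply: nk.
  have [|ss _] := traj (k.*2) a aOm.
    by move=> i _; rewrite ltNge; apply/negP => h; apply: nn; exists i.
  exists (pairs (traject s a k.*2.+1)); first exact: matching_pairs.
  by rewrite size_pairs size_traject /= uphalf_double.
case: (ex_minnP ex) => N Nc Nmin.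
have Nlt i : (i < N)%N -> iter i s a < c.
  by move=> iN; rewrite ltNge; apply/negP => /Nmin; rewrite leqNgt iN.
have [sN ON] := traj N a aOm Nlt.
have NE : iter N s a = c.
  apply: le_anti; rewrite Nc andbT; case: N {Nc Nmin} Nlt sN ON => [_ _ _|N Nlt sN ON].
    exact: a_min.
  have [_ ON'] := traj N a aOm (fun i iN => Nlt i (ltnW iN)).
  by have [_] := sP _ ON' (Nlt N (ltnSn N)).
have rE : rcons (traject s a N) c = traject s a N.+1 by rewrite trajectSr NE.
exists (traject s a N); rewrite /chain rE.
have between n z x : Om z -> (forall i, (i < n)%N -> iter i s z < c) -> Om x ->
    z <= x -> x <= iter n s z -> x \in traject s z n.+1.
  elim: n z => [|n IH] z zO zlt Ox zx /=; first by rewrite inE eq_le zx => ->.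
  move=> xc; rewrite inE eq_sym; case: (ltgtP z x) zx => //= zx _.
  have [[_ Os _ nw] _] := sP z zO (zlt 0%N isT).
  apply: IH => //; first by move=> i iN; rewrite -iterSr; exact: zlt.
    by have := nw x Ox; rewrite zx /= -leNgt.
  by rewrite -iterSr.
have all_ x : Om x -> x <= c -> x \in traject s a N.+1.
  by move=> Ox xc; apply: between => //; rewrite ?NE// a_min.
(* The points before [c] keep a distance [e'] from it (1 if there are none). Hence [c] is a limit of
   points on its right, and no gap starts at [c]. *)
have [e' e'0 eP] : exists2 e' : R, 0 < e' & forall w, Om w -> w < c -> w <= c - e'.
  case: N {Nc Nmin sN ON all_ rE} NE Nlt => [<- _|N NE Nlt].
    by exists 1 => // w /a_min; rewrite leNgt => /negbTE->.
  have [_ ON] := traj N a aOm (fun i iN => Nlt i (ltnW iN)).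
  have [] := sP _ ON (Nlt N (ltnSn N)); rewrite -[s _]/(iter N.+1 s a) NE => -[_ _ xc nw] _.
  exists (c - iter N s a) => [|w /nw]; first by rewrite subr_gt0.
  by move=> + wc; rewrite wc andbT -leNgt subKr.
have right e : 0 < e -> exists2 w, Om w & c < w < c + e.
  move=> e0; have [|w Ow [wc]] := limit_point_near (e := Num.min e e') c_lim.
    by rewrite lt_min e0.
  rewrite lt_min => /andP[we we']; exists w => //.
  have cw : c < w.
    rewrite lt_neqAle eq_sym wc leNgt /=; apply/negP => wc'.
    have := eP w Ow wc'; rewrite leNgt => /negP; apply.
    by move: we'; rewrite ltr_norml ltrBrDl => /andP[+ _]; rewrite addrC.
  by rewrite cw /= -ltrBlDl (le_lt_trans (ler_norm _)).
split => //.
- move=> v [_ _] cv nw; have [|w /nw + /andP[w1 w2]] := right (v - c); first by rewrite subr_gt0.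
  by rewrite w1 /=; move: w2; rewrite addrCA subrr addr0 => ->.
- by have [w Ow /andP[]] := right 1 ltr01; exists w.
Qed.
End Chains.

(** * Rearranging a matching along the chain *)

Section ChainMatchings.
Variables (R : realType) (Om : set R) (a c : R) (xs : seq R).
Hypotheses (aOm : Om a) (a_min : forall x, Om x -> a <= x).
Hypotheses (cOm : Om c) (ch : chain Om xs c).

Lemma chain_le x : x \in rcons xs c -> Om x /\ x <= c.
Proof.
rewrite mem_rcons inE => /orP[/eqP->//|/(chain_mem _ ch cOm)[Ox xc]].
by split=> //; exact: ltW.
Qed.

Lemma chain_behead : a \notin behead (rcons xs c) /\ subseq (behead (rcons xs c)) (rcons xs c).
Proof.
have [ss all_ _ _] := ch.
have acs : a \in rcons xs c by apply: all_ => //; exact: a_min.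
case E : (rcons xs c) => [|z zs]; first by move: acs; rewrite E.
split; last exact: subseq_cons.
have [Oz _] : Om z /\ z <= c by apply: chain_le; rewrite E mem_head.
apply/negP => /= azs; have := gapb_lt ss; rewrite E /= (path_sortedE lt_trans).
by move=> /andP[/allP/(_ _ azs)/=]; rewrite ltNge a_min.
Qed.

(** No gap starts at [c], so every gap of [l] lies in the chain or strictly to the right of [c]. The
    gaps [l1] in the chain can thus be traded for the pairs of a run [zs] without touching the
    others. *)
Lemma chain_exchange l zs : matching Om l -> subseq zs (rcons xs c) ->
    sorted (gapb Om) zs ->
  exists l1 l2, [/\ size l = (size l1 + size l2)%N, matching Om l1,
      {subset ends l1 <= rcons xs c} /\ {subset ends l1 <= ends l},
      matching Om (pairs zs ++ l2)
    & forall x, x \in ends (pairs zs ++ l2) ->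
        x \in zs \/ x \in ends l /\ c < x].
Proof.
move=> ml szs gzs; have [_ all_ nc _] := ch; have [gl _] := ml.
pose l1 := [seq e <- l | e.1 <= c]; pose l2 := [seq e <- l | c < e.1].
have m2 : matching Om l2 := subseq_matching (filter_subseq _ _) ml.
have fil (p : pred (R * R)) : {subset ends [seq e <- l | p e] <= ends l}.
  move=> x /endsP[e]; rewrite mem_filter => /andP[_ el] xe.
  by apply/endsP; exists e.
have e2 x : x \in ends l2 -> c < x.
  move=> /endsP[e]; rewrite mem_filter => /andP[ce /gl[_ _ e12 _]] [] -> //.
  exact: lt_trans e12.
exists l1, l2; split.
- rewrite !size_filter -(count_predC (fun e => e.1 <= c)); congr (_ + _)%N.
  by apply: eq_count => e /=; rewrite ltNge.
- exact: subseq_matching (filter_subseq _ _) ml.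
- split=> [x /endsP[e]|]; last exact: fil.
  rewrite mem_filter => /andP[ec /gl g] xe; have [g1 g2 e12 ne12] := g.
  have {}ec : e.1 < c.
    rewrite lt_neqAle ec andbT; apply/eqP => ecE.
    by apply: (nc e.2); rewrite -ecE.
  case: xe => ->; apply: all_ => //; first exact: ltW.
  by have := ne12 c cOm; rewrite ec /= -leNgt.
- apply: matching_cat => //; first exact: matching_pairs.
  move=> x /(mem_subseq (ends_pairs_subseq _))/(mem_subseq szs)/chain_le[_ xc].
  by apply/negP => /e2; rewrite ltNge xc.
- move=> x; rewrite ends_cat mem_cat => /orP[/(mem_subseq (ends_pairs_subseq _))|x2]; first by left.
  by right; split; [exact: fil x2|exact: e2].
Qed.

(** The points of the chain, [c] included, are even in number and can all be paired. A matching
    without [a] leaves one of them out and has fewer gaps there. *)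
Lemma chain_odd l : odd (size xs) -> matching Om l -> a \notin ends l ->
  exists l', [/\ matching Om l', (size l < size l')%N
    & forall x, x \in ends l' -> x \in ends l \/ x <= c].
Proof.
move=> oxs ml al; have [ss _ _ _] := ch; have [aB _] := chain_behead.
have [l1 [l2 [sl m1 [e1 e1l] m12 e12]]] := chain_exchange ml (subseq_refl _) ss.
exists (pairs (rcons xs c) ++ l2); split=> //; last first.
  by move=> x /e12[/chain_le[_]|[]]; [right|left].
have : (size (a :: ends l1) <= size (rcons xs c))%N.
  apply: uniq_leq_size => [|x] /=.
    by have [_ ->] := m1; rewrite andbT; apply: contra al => /e1l.
  have [_ all_ _ _] := ch.
  by rewrite inE => /orP[/eqP->|/e1//]; apply: all_ => //; exact: a_min.
rewrite size_cat size_pairs sl /= size_ends size_rcons.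
rewrite ?uphalf_half; move: oxs (odd_double_half (size xs)); clear.
move: (size xs) (size l1) (size l2) => p q r; case: (odd p) => // _ /=; lia.
Qed.

(** With [c] the chain has an odd number of points, so some point is left out by any matching;
    leaving out [a] loses nothing. *)
Lemma chain_even l : ~~ odd (size xs) -> matching Om l ->
  exists l', [/\ matching Om l', (size l <= size l')%N, a \notin ends l'
    & forall x, x \in ends l' -> x \in ends l \/ x <= c].
Proof.
move=> oxs ml; have [ss _ _ _] := ch; have [aB sB] := chain_behead.
have sgB : sorted (gapb Om) (behead (rcons xs c)).
  by case: (rcons xs c) ss => // z zs /path_sorted.
have [l1 [l2 [sl m1 [e1 e1l] m12 e12]]] := chain_exchange ml sB sgB.
exists (pairs (behead (rcons xs c)) ++ l2); split=> //; last first.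
- by move=> x /e12[/(mem_subseq sB)/chain_le[_]|[]]; [right|left].
- apply/negP => /e12[|[_]]; first by rewrite (negbTE aB).
  by rewrite ltNge a_min.
have : (size (ends l1) <= size (rcons xs c))%N.
  by apply: uniq_leq_size e1; case: m1.
rewrite size_cat size_pairs sl /= size_ends size_behead size_rcons /=.
rewrite ?uphalf_half; move: oxs (odd_double_half (size xs)); clear.
move: (size xs) (size l1) (size l2) => p q r; case: (odd p) => // _ /=; lia.
Qed.
End ChainMatchings.

(** * The reflection x -> -x, which exchanges left and right *)

Section Reflection.
Variables (R : realType) (Om : set R).

Definition oppset (A : set R) : set R := [set x | A (- x)].

Lemma oppsetK : oppset (oppset Om) = Om.
Proof. by apply/seteqP; split=> x; rewrite /oppset /= opprK. Qed.

Definition oppl (l : seq (R * R)) := [seq (- e.2, - e.1) | e <- l].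

Lemma ends_oppl l x : (x \in ends (oppl l)) = (- x \in ends l).
Proof.
elim: l => // e l IH; rewrite -[ends (oppl _)]/(- e.2 :: - e.1 :: ends (oppl l)).
by rewrite -[ends (_ :: _)]/(e.1 :: e.2 :: ends l) !inE IH !eqr_oppLR orbCA.
Qed.

Lemma gap_opp u v : gap Om u v -> gap (oppset Om) (- v) (- u).
Proof.
move=> [Ou Ov uv nuv]; split; rewrite /oppset /= ?opprK ?ltrN2// => w /nuv.
by rewrite ltrNr ltrNl andbC.
Qed.

Lemma matching_opp l : matching Om l -> matching (oppset Om) (oppl l).
Proof.
move=> [gl ul]; split=> [e /mapP[e' /gl/gap_opp g ->//]|].
elim: l {gl} ul => // e l IH.
rewrite -[ends (oppl _)]/(- e.2 :: - e.1 :: ends (oppl l)).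
rewrite -[ends (_ :: _)]/(e.1 :: e.2 :: ends l) /= !inE !ends_oppl !opprK.
by rewrite eqr_opp !negb_or [e.2 == _]eq_sym => /and3P[/andP[-> ->] -> /IH ->].
Qed.

Lemma oppset_compact : compact Om -> compact (oppset Om).
Proof.
have -> : oppset Om = -%R @` Om.
  by apply/seteqP; split=> [x Ox|_ [x Ox <-]]; rewrite /oppset /= ?opprK//; exists (- x); rewrite ?opprK.
by apply: continuous_compact => x; apply: continuous_subspaceT; exact: opp_continuous.
Qed.

Lemma limit_point_opp x : limit_point Om x -> limit_point (oppset Om) (- x).
Proof.
move=> Ox U /nbhs_norm_lt[e e0 eU].
have [w Ow [wx we]] := limit_point_near Ox e0.
exists (- w); split; first by rewrite eqr_opp.
  by rewrite /oppset /= opprK.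
by apply: eU; rewrite -opprB normrN opprK addrC.
Qed.

End Reflection.

(** * Parities of the eccentric points and largest matchings *)

Section Parities.
Variables (R : realType) (Om : set R) (a b : R).
Hypotheses (Om_compact : compact Om) (Om_infinite : infinite_set Om).
Hypotheses (aOm : Om a) (a_min : forall x, Om x -> a <= x).
Hypotheses (bOm : Om b) (b_max : forall x, Om x -> x <= b).

Lemma limit_point_bounds : exists c c', [/\ limit_point Om c, limit_point Om c',
  forall x, limit_point Om x -> c <= x & forall x, limit_point Om x -> x <= c'].
Proof.
have cO : closed Om := compact_closed (@norm_hausdorff _ _) Om_compact.
have clL : closed (limit_point Om).
  by apply: limit_point_closed; apply: hausdorff_accessible; exact: norm_hausdorff.
have L0 := infinite_bounded_limit_point_nonempty Om_infinite (compact_bounded Om_compact).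
have LO x : limit_point Om x -> Om x by move=> /subset_limit_point/cO.
have [c Lc cP] : exists2 x, limit_point Om x & forall y, limit_point Om y -> x <= y.
  by apply: closed_min => //; exists a => x /LO/a_min.
have [c' Lc' cP'] : exists2 x, limit_point Om x & forall y, limit_point Om y -> y <= x.
  by apply: closed_max => //; exists b => x /LO/b_max.
by exists c, c'; split.
Qed.

Lemma conv_limit_pointsE c c' : limit_point Om c -> limit_point Om c' ->
    (forall x, limit_point Om x -> c <= x) -> (forall x, limit_point Om x -> x <= c') ->
  conv_limit_points Om = `[c, c']%classic.
Proof.
move=> Lc Lc' cP cP'; apply/seteqP; split.
  rewrite /conv_limit_points Rhull_smallest; apply: smallest_sub.
    exact: interval_is_interval.
  by move=> x Lx; rewrite /= in_itv /= cP// cP'.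
move=> x; rewrite /= in_itv /= => xcc'.
have := @interval_is_interval R (Rhull (limit_point Om)).
move=> /(_ c c') iv; apply: iv xcc'; exact: sub_Rhull.
Qed.

Lemma size_fset_set (A : set R) (s : seq R) : uniq s -> A = [set` s] ->
  #|` fset_set A| = size s.
Proof.
move=> us ->; have -> : [set` s] = [set` [fset x in s]%fset].
  by apply/seteqP; split=> x /=; rewrite in_fset.
by rewrite set_fsetK card_fseq undup_id.
Qed.

(** The eccentric points on the left are the points of [Om] below the least limit point. *)
Lemma Theta_l_chain k : ~ has_matching Om k ->
  exists c xs, [/\ Om c, chain Om xs c & Theta_l Om = odd (size xs)].
Proof.
move=> nk; have [c [c' [Lc Lc' cP cP']]] := limit_point_bounds.
have [xs ch] := chain_exists Om_compact aOm a_min Lc cP nk.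
have Oc : Om c by apply: (compact_closed (@norm_hausdorff _ _) Om_compact); exact: subset_limit_point.
exists c, xs; split => //; rewrite /Theta_l; congr (nat_of_bool (odd _)).
apply: size_fset_set.
  have [ss _ _ _] := ch; have := gapb_lt ss.
  by rewrite -cats1 => /cat_sorted2[/(sorted_uniq lt_trans (@ltxx _ _))].
rewrite /eccentric_left /eccentric (conv_limit_pointsE Lc Lc' cP cP').
have cc' : c <= c' := cP _ Lc'.
apply/seteqP; split=> x /=.
  move=> [[Ox _] /(_ c)]; rewrite in_itv /= lexx cc' => /(_ isT) xc.
  exact/(chain_mem _ ch Oc).
move=> /(chain_mem _ ch Oc)[Ox xc]; split; [split=> //|].
  by rewrite in_itv /= leNgt xc.
by move=> y; rewrite in_itv /= => /andP[cy _]; exact: lt_le_trans cy.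
Qed.

Lemma Theta_r_chain k : ~ has_matching Om k ->
  exists c xs, [/\ oppset Om c, chain (oppset Om) xs c & Theta_r Om = odd (size xs)].
Proof.
move=> nk; have [c [c' [Lc Lc' cP cP']]] := limit_point_bounds.
have nk' : ~ has_matching (oppset Om) k.
  move=> [l /matching_opp ml sl]; apply: nk; exists (oppl l).
    by rewrite -(oppsetK Om).
  by rewrite size_map.
have [] := @chain_exists _ _ (oppset_compact Om_compact) (- b) (- c') _ _ _ _ _ nk'.
- by rewrite /oppset /= opprK.
- by move=> x /b_max; rewrite lerNl.
- exact: limit_point_opp.
- by move=> x /limit_point_opp; rewrite oppsetK lerNl; exact: cP'.
move=> xs ch.
have Oc : oppset Om (- c').
  rewrite /oppset /= opprK; apply: (compact_closed (@norm_hausdorff _ _) Om_compact).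
  exact: subset_limit_point.
exists (- c'), xs; split => //; rewrite /Theta_r; congr (nat_of_bool (odd _)).
rewrite -[RHS](size_map -%R); apply: size_fset_set.
  rewrite map_inj_uniq; last exact: oppr_inj.
  have [ss _ _ _] := ch; have := gapb_lt ss.
  by rewrite -cats1 => /cat_sorted2[/(sorted_uniq lt_trans (@ltxx _ _))].
rewrite /eccentric_right /eccentric (conv_limit_pointsE Lc Lc' cP cP').
have cc' : c <= c' := cP _ Lc'.
apply/seteqP; split=> x /=.
  move=> [[Ox _] /(_ c')]; rewrite in_itv /= lexx cc' => /(_ isT) xc.
  rewrite -[x]opprK map_f//; apply/(chain_mem _ ch Oc).
  by rewrite /oppset /= opprK ltrN2.
move=> /mapP[y /(chain_mem _ ch Oc)[Oy yc] ->]; split; [split=> //|].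
  by rewrite in_itv /= lerNl [- c' <= y]leNgt yc andbF.
by move=> z; rewrite in_itv /= => /andP[_ zc]; rewrite ltrNr (lt_le_trans yc)// lerN2.
Qed.

(** Only points up to the least limit point are matched anew, and [b] lies beyond it; so the two
    sides can be treated one after the other. *)
Lemma left_extend k l : ~ has_matching Om k -> Theta_l Om = 1%N ->
    matching Om l -> a \notin ends l ->
  exists l', [/\ matching Om l', (size l < size l')%N
    & b \notin ends l -> b \notin ends l'].
Proof.
move=> nk; have [c [xs [Oc ch ->]]] := Theta_l_chain nk.
case oxs : (odd _) => // _ ml al.
have [l' [ml' sl' el']] := chain_odd aOm a_min Oc ch oxs ml al.
exists l'; split => // bl; apply/negP => /el'[|bc]; first by rewrite (negbTE bl).
by have [_ _ _ [w /b_max wb]] := ch; rewrite ltNge (le_trans wb).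
Qed.

Lemma left_avoid k l : ~ has_matching Om k -> Theta_l Om = 0%N ->
    matching Om l ->
  exists l', [/\ matching Om l', (size l <= size l')%N, a \notin ends l'
    & b \notin ends l -> b \notin ends l'].
Proof.
move=> nk; have [c [xs [Oc ch ->]]] := Theta_l_chain nk.
case oxs : (odd _) => // _ ml.
have [l' [ml' sl' al' el']] := chain_even aOm a_min Oc ch (negbT oxs) ml.
exists l'; split => // bl; apply/negP => /el'[|bc]; first by rewrite (negbTE bl).
by have [_ _ _ [w /b_max wb]] := ch; rewrite ltNge (le_trans wb).
Qed.

Let bOm' : oppset Om (- b). Proof. by rewrite /oppset /= opprK. Qed.
Let b_min' x : oppset Om x -> - b <= x. Proof. by move=> /b_max; rewrite lerNl. Qed.
Let a_max' x : oppset Om x -> x <= - a. Proof. by move=> /a_min; rewrite lerNr. Qed.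

Lemma right_extend k l : ~ has_matching Om k -> Theta_r Om = 1%N ->
    matching Om l -> b \notin ends l ->
  exists l', [/\ matching Om l', (size l < size l')%N
    & a \notin ends l -> a \notin ends l'].
Proof.
move=> nk; have [c [xs [Oc ch ->]]] := Theta_r_chain nk.
case oxs : (odd _) => // _ /matching_opp ml bl.
have [|l' [ml' sl' el']] := chain_odd bOm' b_min' Oc ch oxs ml.
  by rewrite ends_oppl opprK.
exists (oppl l'); split; first by rewrite -(oppsetK Om); exact: matching_opp.
  by move: sl'; rewrite !size_map.
rewrite !ends_oppl => al; apply/negP => /el'[|bc].
  by rewrite ends_oppl opprK (negbTE al).
by have [_ _ _ [w /a_max' wb]] := ch; rewrite ltNge (le_trans wb).
Qed.

Lemma right_avoid k l : ~ has_matching Om k -> Theta_r Om = 0%N ->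
    matching Om l ->
  exists l', [/\ matching Om l', (size l <= size l')%N, b \notin ends l'
    & a \notin ends l -> a \notin ends l'].
Proof.
move=> nk; have [c [xs [Oc ch ->]]] := Theta_r_chain nk.
case oxs : (odd _) => // _ /matching_opp ml.
have [l' [ml' sl' bl' el']] := chain_even bOm' b_min' Oc ch (negbT oxs) ml.
exists (oppl l'); split; first by rewrite -(oppsetK Om); exact: matching_opp.
- by move: sl'; rewrite !size_map.
- by rewrite ends_oppl.
rewrite !ends_oppl => al; apply/negP => /el'[|bc].
  by rewrite ends_oppl opprK (negbTE al).
by have [_ _ _ [w /a_max' wb]] := ch; rewrite ltNge (le_trans wb).
Qed.

End Parities.

(** * Upper bounds *)

Section RealPolynomials.
Variable R : realType.
Implicit Types (p q : {poly R}) (x : R) (rs : seq R).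

Lemma poly_real_roots p : p != 0 ->
  exists q rs, p = q * \prod_(z <- rs) ('X - z%:P) /\ forall x, ~~ root q x.
Proof.
have [n] := ubnP (size p); elim: n p => // n IH p sp p0.
have [[x px]|nr] := pselect (exists x, root p x); last first.
  by exists p, [::]; rewrite big_nil mulr1; split=> // x; apply/negP => px; apply: nr; exists x.
have /factor_theorem[p' pE] := px.
have p'0 : p' != 0 by apply: contra p0 => /eqP p'0; rewrite pE p'0 mul0r.
have [|q [rs [p'E nq]]] := IH p' _ p'0.
  by move: sp; rewrite pE size_Mmonic ?monicXsubC// size_XsubC addn2.
by exists q, (x :: rs); split=> //; rewrite pE big_cons p'E -mulrA [X in q * X]mulrC.
Qed.

Lemma rootless_sign q : (forall x, ~~ root q x) ->
  exists s : bool, forall x, (q.[x] < 0) = s.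
Proof.
move=> nq; exists (q.[0] < 0) => x.
have ivt (y z : R) : q.[y] < 0 -> q.[z] < 0.
  move=> yq; rewrite ltNge; apply/negP => zq.
  case: (leP y z) => [yz|/ltW zy].
    have [t _ qt] := poly_ivt yz (introT andP (conj (ltW yq) zq)).
    by have := nq t; rewrite qt.
  have : (- q).[z] <= 0 <= (- q).[y] by rewrite !hornerN oppr_le0 oppr_ge0 zq ltW.
  by move=> /(poly_ivt zy)[t _]; rewrite rootN => qt; have := nq t; rewrite qt.
by apply/idP/idP; exact: ivt.
Qed.

Lemma prod_sign rs x : x \notin rs ->
  (\prod_(z <- rs) ('X - z%:P)).[x] != 0 /\
  ((\prod_(z <- rs) ('X - z%:P)).[x] < 0) = odd (count (> x) rs).
Proof.
elim: rs => [_|z rs IH]; first by rewrite big_nil hornerC oner_eq0 ltNge ler01.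
rewrite inE negb_or => /andP[xz /IH[nz sg]].
rewrite big_cons hornerM hornerXsubC mulf_eq0 subr_eq0 (negbTE xz) nz /= oddD -sg.
split=> //; case: (ltgtP x z) xz => //= xz _.
  by rewrite nmulr_rlt0 ?subr_lt0// lt_neqAle eq_sym nz leNgt.
by rewrite pmulr_rlt0 ?subr_gt0.
Qed.

(** [p] is a product of linear factors and a rootless factor of constant sign. That sign and the
    parity of the number of larger roots give the sign of [p] off its roots. *)
Lemma poly_matching_bound (Om : set R) (a b : R) (m : nat) p (s : seq R) :
    Om a -> (forall x, Om x -> a <= x) -> Om b -> (forall x, Om x -> x <= b) ->
    p != 0 -> (size p <= m.+1)%N -> (forall x, Om x -> 0 <= p.[x]) ->
    sorted <%R s -> (forall y, y \in s -> Om y) -> (forall y, y \in s -> root p y) ->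
  exists l (ba bb : bool),
    [/\ matching Om l, {subset ends l <= s}, (ba -> a \notin ends l /\ a \in s),
        (bb -> b \notin ends l /\ b \in s)
      & ((size s).*2 <= m + (size l).*2 + ba + bb)%N].
Proof.
move=> aOm a_min bOm b_max p0 sp p_ge0 ss sOm sp0.
have [q [rs [pE nq]]] := poly_real_roots p0.
have [sg sgP] := rootless_sign nq.
have q0 : q != 0 by apply: contra p0 => /eqP q0; rewrite pE q0 mul0r.
have [|y ys|l [ba [bb [h1 h2 h3 h4 h5]]]] := matching_bound aOm a_min bOm b_max (rs := rs) (neg0 := sg) _ ss sOm.
- move=> v Ov vrs; have := p_ge0 v Ov; rewrite pE hornerM.
  have [nz <-] := prod_sign vrs; rewrite -(sgP v).
  move: (nq v) nz; rewrite /root; move: q.[v] ((\prod_(z <- rs) ('X - z%:P)).[v]) => y z y0 z0.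
  case: (ltgtP y 0) y0 => //= y0 _; case: (ltgtP z 0) z0 => //= z0 _.
    by rewrite nmulr_rge0// leNgt z0.
  by rewrite pmulr_rge0// leNgt z0.
- have := sp0 y ys; rewrite pE rootM (negbTE (nq y)) /= root_prod_XsubC.
  by [].
exists l, ba, bb; split=> //; apply: leq_trans h5 _; rewrite !leq_add2r.
have := sp; rewrite pE size_Mmonic ?monic_prod_XsubC// size_prod_XsubC.
have := q0; rewrite -size_poly_gt0; clear; lia.
Qed.

(* The only consequence of the existence of a positive basis with [size T]
   elements that is needed for the upper bounds. *)
Definition peaked (Om : set R) (m : nat) (T : seq R) : Prop :=
  [/\ uniq T, forall x, x \in T -> Om x & forall x, x \in T ->
    exists p, [/\ p != 0, (size p <= m.+1)%N, forall w, Om w -> 0 <= p.[w]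
      & forall y, y \in T -> y != x -> root p y]].

Lemma peaked_sort Om m T : peaked Om m T -> peaked Om m (sort <=%R T).
Proof.
move=> [uT TOm Tp]; split=> [|x|x]; rewrite ?sort_uniq ?mem_sort//; first exact: TOm.
by move=> /Tp[p [p0 sp pw py]]; exists p; split=> // y; rewrite mem_sort; exact: py.
Qed.

End RealPolynomials.

(** * Bounds from counting zeros *)

Section UpperBounds.
Variables (R : realType) (Om : set R) (a b : R) (m : nat).
Hypotheses (Om_compact : compact Om) (Om_infinite : infinite_set Om).
Hypotheses (aOm : Om a) (a_min : forall x, Om x -> a <= x).
Hypotheses (bOm : Om b) (b_max : forall x, Om x -> x <= b).
Implicit Types T : seq R.

(** The zeros of the polynomial belonging to [x] include the rest of [T]. The choice of [x] is left
    open: it serves to exclude [ba] or [bb], or to make [l] extensible. *)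
Lemma peaked_bound T x : peaked Om m T -> x \in T ->
  exists l (ba bb : bool),
    [/\ matching Om l, (forall y, y \in ends l -> y \in T /\ y != x),
        (ba -> [/\ a \notin ends l, a \in T & a != x]),
        (bb -> [/\ b \notin ends l, b \in T & b != x])
      & ((size T).*2 <= m + 2 + (size l).*2 + ba + bb)%N].
Proof.
move=> pT xT; have [uS SOm Sp] := peaked_sort pT; have [uT _ _] := pT.
set S := sort <=%R T in uS SOm Sp.
have xS : x \in S by rewrite mem_sort.
have [p [p0 sp p_ge0 px]] := Sp x xS.
have mem_s y : (y \in [seq y <- S | y != x]) = (y \in T) && (y != x).
  by rewrite mem_filter mem_sort andbC.
have [||y ys|l [ba [bb [ml el al bl sl]]]] := @poly_matching_bound _ _ a b m p
    [seq y <- S | y != x] aOm a_min bOm b_max p0 sp p_ge0.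
- apply: sorted_filter; first exact: lt_trans.
  by rewrite lt_sorted_uniq_le uS sort_le_sorted.
- by move=> y; rewrite mem_filter => /andP[_ /SOm].
- by move: ys; rewrite mem_filter => /andP[yx yS]; exact: px.
exists l, ba, bb; split => //.
- by move=> y /el; rewrite mem_s => /andP.
- by move=> /al[-> ]; rewrite mem_s => /andP[].
- by move=> /bl[-> ]; rewrite mem_s => /andP[].
have <- : (count (fun y => y != x) S).+1 = size T.
  rewrite -(size_sort <=%R) -/S -(count_predC (pred1 x) S) count_uniq_mem// xS.
  by rewrite add1n.
by move: sl; rewrite size_filter; move: (count _ S) (size l) => k k'; clear; case: ba; case: bb => /=; lia.
Qed.

Lemma no_matching_size k l : ~ has_matching Om k.+1 -> matching Om l -> (size l <= k)%N.
Proof.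
move=> nk ml; rewrite leqNgt; apply/negP => kl; apply: nk.
by apply: has_matching_le kl _; exists l.
Qed.

(** Without gaps only the two extreme points can save roots, and omitting [a] rules out one of
    them. *)
Lemma peaked_no_hole T : ~ has_matching Om 1 -> peaked Om m T ->
  ((size T).*2 <= m + 3)%N.
Proof.
move=> n1 pT; case: T pT => // t T pT.
pose x := if a \in t :: T then a else t.
have xT : x \in t :: T by rewrite /x; case: ifP => //; rewrite mem_head.
have [l [ba [bb [ml _ al _ sl]]]] := peaked_bound pT xT.
have := no_matching_size n1 ml.
have {al} : ~~ ba by apply/negP => /al[_ aT]; rewrite /x aT eqxx.
by move: sl; clear; case: ba; case: bb => //=; lia.
Qed.

Lemma peaked_holes T r : ~ has_matching Om r.+1 -> (0 < r)%N -> peaked Om m T ->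
  ((size T).*2 + Theta_l Om + Theta_r Om <= m + 2 + r.*2)%N.
Proof.
move=> nr r0; case: T => [_|t T pT].
  have Tl : (Theta_l Om <= 1)%N by exact: leq_b1.
  have Tr : (Theta_r Om <= 1)%N by exact: leq_b1.
  by move: Tl Tr; clear; rewrite /=; lia.
have side y : exists2 x, x \in t :: T & y \in t :: T -> x = y.
  by case: (boolP (y \in t :: T)) => yT; [exists y|exists t => //; rewrite mem_head].
have size_le := no_matching_size nr.
have [Tl1|Tl0] : Theta_l Om = 1%N \/ Theta_l Om = 0%N.
  by rewrite /Theta_l; case: odd; [left|right].
  (* With [a] omitted (any point if [a] is not in [T]), the matching misses [a], so it can be
     enlarged and has fewer than [r] gaps. *)
  have [x xT ax] := side a.
  have [l [ba [bb [ml el al bl sl]]]] := peaked_bound pT xT.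
  have {}al : ~~ ba by apply/negP => /al[_ /ax->]; rewrite eqxx.
  have aNl : a \notin ends l by apply/negP => /el[/ax->]; rewrite eqxx.
  have [l' [ml' ll' bl']] := left_extend Om_compact Om_infinite aOm a_min b_max nr Tl1 ml aNl.
  have [Tr1|Tr0] : Theta_r Om = 1%N \/ Theta_r Om = 0%N.
    by rewrite /Theta_r; case: odd; [left|right].
    case: bb => [|] in bl sl *; last first.
      move: (size_le _ ml') ll' sl al; rewrite Tl1 Tr1; clear; case: ba => //=; lia.
    (* If [b] saves a root, [l'] misses [b] as well and can be enlarged a second time. *)
    have [/bl' bNl _ _] := bl isT.
    have [l'' [/size_le + ll'' _]] := right_extend Om_compact Om_infinite a_min bOm b_max nr Tr1 ml' bNl.
    by move: ll' ll'' sl al; rewrite Tl1 Tr1; clear; case: ba => //=; lia.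
  by move: (size_le _ ml') ll' sl al; rewrite Tl1 Tr0; clear; case: ba; case: bb => //=; lia.
have [Tr1|Tr0] : Theta_r Om = 1%N \/ Theta_r Om = 0%N.
  by rewrite /Theta_r; case: odd; [left|right].
  have [x xT bx] := side b.
  have [l [ba [bb [ml el al bl sl]]]] := peaked_bound pT xT.
  have {}bl : ~~ bb by apply/negP => /bl[_ /bx->]; rewrite eqxx.
  have bNl : b \notin ends l by apply/negP => /el[/bx->]; rewrite eqxx.
  have [l' [ml' ll' _]] := right_extend Om_compact Om_infinite a_min bOm b_max nr Tr1 ml bNl.
  by move: (size_le _ ml') ll' sl bl; rewrite Tl0 Tr1; clear; case: ba; case: bb => //=; lia.
rewrite Tl0 Tr0 !addn0.
pose G y := (y \in t :: T) && has (fun u => gapb Om u y) (t :: T).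
have [[x Gx xmin]|noG] := pselect (exists2 x, G x & forall y, G y -> x <= y).
  have /andP[xT /hasP[u uT /asboolP gux]] := Gx.
  have [l [ba [bb [ml el al bl sl]]]] := peaked_bound pT xT.
  have [gl _] := ml; have [Ou Ox ux _] := gux.
  (* A gap of [l] starting at [u] would be [(u, x)], but [x] is omitted; one ending at [u] would
     contradict the minimality of [x]. So [l] has fewer than [r] gaps. *)
  have mux : matching Om ((u, x) :: l).
    apply/matching_consE; split=> //=; last by apply/negP => /el[_]; rewrite eqxx.
    apply/negP => /endsP[[u' v'] el' /= ue].
    have /= [gu' gv' uv' nuv'] := gl _ el'.
    have v'e : v' \in ends l by apply/endsP; exists (u', v') => //; right.
    have u'e : u' \in ends l by apply/endsP; exists (u', v') => //; left.
    have [v'T v'x] := el _ v'e; have [u'T _] := el _ u'e.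
    case: ue => ue.
      have [_ _ _ nux] := gux; have := nux _ gv'; have := nuv' _ Ox.
      by rewrite -ue ux ue uv' /= -!leNgt => h1 h2; move: v'x; rewrite eq_le h1 h2.
    have Gu : G u.
      by rewrite /G uT; apply/hasP; exists u' => //; apply/asboolP; rewrite ue; exact: (gl _ el').
    by have := xmin u Gu; rewrite leNgt ux.
  by move: (size_le _ mux) sl => /=; clear; case: ba; case: bb => /=; lia.
have {}noG x : ~~ G x.
  apply/negP => Gx; apply: noG.
  have [s ss] : exists s : seq R, forall y, G y = (y \in s).
    by exists [seq y <- t :: T | G y] => y; rewrite mem_filter /G; case: (_ \in _); rewrite ?andbF ?andbT.
  have : sort <=%R s != [::].
    by apply/eqP => s0; move: Gx; rewrite ss -(mem_sort <=%R) s0.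
  have := sort_le_sorted s; case E : (sort _ s) => [//|y s'] /= ys' _.
  exists y; first by rewrite ss -(mem_sort <=%R) E mem_head.
  move=> z; rewrite ss -(mem_sort <=%R) E inE => /orP[/eqP->//|].
  by move: ys'; rewrite (path_sortedE le_trans) => /andP[/allP h _] /h.
(* No gap has both ends in [T], so [l] is empty, and [0 < r] gives the bound. *)
have [l [ba [bb [ml el al bl sl]]]] := peaked_bound pT (mem_head t T).
have l0 : l = [::].
  case: l ml el {al bl sl} => // -[u v] l [gl _] el.
  have [uT _] : u \in t :: T /\ u != t by apply: el; rewrite mem_head.
  have [vT _] : v \in t :: T /\ v != t by apply: el; rewrite inE mem_head orbT.
  have := noG v; rewrite /G vT /= -/(has _ (t :: T)) => /hasP[]; exists u => //.
  by apply/asboolP; apply: (gl (u, v)); rewrite mem_head.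
by move: sl r0; rewrite l0 /=; clear; case: ba; case: bb => /=; lia.
Qed.

End UpperBounds.

(** * The bound by the degree *)

Section SmallDegree.
Variables (R : realType) (Om : set R) (m : nat).
Implicit Types (p : {poly R}) (s T : seq R).

Lemma poly_all_roots p s : uniq s -> all (root p) s -> p != 0 ->
  (size p <= (size s).+1)%N ->
  exists2 c, c != 0 & p = c *: \prod_(z <- s) ('X - z%:P).
Proof.
move=> us ps p0 sp; set q := \prod_(z <- s) _.
have qp : q %| p by apply: uniq_roots_dvdp; rewrite ?uniq_rootsE.
have : q %= p.
  rewrite -dvdp_size_eqp// eqn_leq dvdp_leq// size_prod_XsubC.
  by [].
move=> /eqpP[[c1 c2] /= /andP[c10 c20] E]; exists (c2^-1 * c1).
  by rewrite mulf_neq0 ?invr_eq0.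
by rewrite -scalerA E scalerA mulVf// scale1r.
Qed.

(* If [size T = m.+1], all zeros are simple; the signs of the three polynomials
   peaking at the three leftmost points of [T] are incompatible at any further
   point [w] of [Om]. *)
Lemma peaked_size T : infinite_set Om -> (1 < m)%N -> peaked Om m T -> (size T <= m)%N.
Proof.
move=> iOm m1 /peaked_sort; rewrite -(size_sort <=%R T).
have := sort_le_sorted T; set S := sort _ T; move: S => {T} S srt pS.
rewrite leqNgt; apply/negP => mS.
case: S => [|t1 [|t2 [|t3 T]]] // in srt pS mS; try by move: mS => /=; lia.
have [uT TOm Tp] := pS.
have [t12 t23 t3T] : [/\ t1 < t2, t2 < t3 & forall y, y \in T -> t3 < y].
  have : sorted <%R [:: t1, t2, t3 & T] by rewrite lt_sorted_uniq_le uT.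
  by rewrite /= (path_sortedE lt_trans) => /and3P[-> -> /andP[/allP]].
(* [rho] collects the factors at the points beyond [t3], so it keeps one sign up to [t3]; its sign
   at [w] will cancel. *)
pose rho x := (\prod_(z <- T) ('X - z%:P)).[x].
have rho_gt0 x y : x <= t3 -> y <= t3 -> 0 < rho x * rho y.
  move=> xt yt; rewrite /rho !horner_prod -big_split /= big_seq.
  apply: prodr_gt0 => z /t3T tz; rewrite !hornerXsubC nmulr_rgt0 subr_lt0.
    exact: le_lt_trans tz.
  exact: le_lt_trans tz.
have [w [Ow wT]] : exists w, Om w /\ w \notin [:: t1, t2, t3 & T].
  have : infinite_set (Om `\` [set` [:: t1, t2, t3 & T]]).
    by apply: infinite_setD => //; exact: finite_seq.
  by move=> /infinite_setN0[w [Ow /negP wT]]; exists w.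
(* The known zeros exhaust the degree, so the polynomial belonging to [x] is [c (X - y) (X - z)]
   times the factors in [rho]. *)
have peak x y z : perm_eq [:: x; y; z] [:: t1; t2; t3] ->
    exists c, 0 < c * (x - y) * (x - z) * rho x /\
              0 < c * (w - y) * (w - z) * rho w.
  move=> pe.
  have pe' : perm_eq [:: x, y, z & T] [:: t1, t2, t3 & T].
    by rewrite -[X in perm_eq X _]/([:: x; y; z] ++ T) -[X in perm_eq _ X]/([:: t1; t2; t3] ++ T) perm_cat2r.
  have xS : x \in [:: t1, t2, t3 & T] by rewrite -(perm_mem pe') mem_head.
  have [p [p0 sp p_ge0 py]] := Tp x xS.
  have /= /andP[xyz uyz] : uniq [:: x, y, z & T] by rewrite (perm_uniq pe').
  have [||c c0 pE] := @poly_all_roots p [:: y, z & T] uyz _ p0.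
  - apply/allP => v vyz; apply: py; first by rewrite -(perm_mem pe') inE vyz orbT.
    by apply: contraNneq xyz => <-.
  - apply: leq_trans sp _; move: mS; rewrite -(perm_size pe') /=; lia.
  have pv v : v \notin [:: y, z & T] -> Om v -> 0 < c * (v - y) * (v - z) * rho v.
    move=> vyz Ov; have := p_ge0 v Ov; rewrite pE hornerZ !big_cons !hornerM !hornerXsubC !mulrA.
    rewrite le_eqVlt => /orP[/eqP/esym/eqP|//]; rewrite !mulf_eq0 (negbTE c0) /= !subr_eq0.
    move: vyz; rewrite !inE !negb_or => /and3P[/negbTE-> /negbTE-> vT] /=.
    by rewrite -/(root _ _) root_prod_XsubC (negbTE vT).
  exists c; split; apply: pv => //; first exact: TOm.
  by move: wT; rewrite -(perm_mem pe') inE negb_or => /andP[].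
have [c1 [A1 B1]] := peak t1 t2 t3 (perm_refl _).
have [|c2 [A2 B2]] := peak t2 t1 t3; first by rewrite (perm_catCA [:: t2] [:: t1] [:: t3]).
have [|c3 [A3 B3]] := peak t3 t1 t2.
  by rewrite (perm_catC [:: t3] [:: t1; t2]).
have t13 := lt_trans t12 t23.
have r12 := rho_gt0 t1 t2 (ltW t13) (ltW t23).
have r13 := rho_gt0 t1 t3 (ltW t13) (lexx t3).
have sq_gt0 (x y : R) : 0 < x * y ^+ 2 -> 0 < x.
  move=> xy; rewrite ltNge; apply/negP => x0.
  by move: xy; rewrite ltNge mulr_le0_ge0// sqr_ge0.
(* The product of the inequalities for [t1] and [t3] is [(w - t1) (w - t3)] times the positive [D]
   and a square, so [w] is outside [[t1, t3]]. The pair [t1], [t2] then puts [w] between these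
   two. *)
have h13 : 0 < (w - t1) * (w - t3).
  have D : 0 < (t2 - t1) * (t3 - t1) * (t3 - t1) * (t3 - t2) by rewrite !mulr_gt0// subr_gt0.
  rewrite -(pmulr_lgt0 _ D).
  apply: (sq_gt0 _ (c1 * c3 * (w - t2) * rho w * rho t1 * rho t3)).
  have := mulr_gt0 (mulr_gt0 (mulr_gt0 A1 A3) (mulr_gt0 B1 B3)) r13.
  by congr (_ < _); ring.
have h12 : (w - t1) * (w - t2) < 0.
  have D : 0 < (t2 - t1) * (t3 - t1) * (t2 - t1) * (t3 - t2) by rewrite !mulr_gt0// subr_gt0.
  rewrite -oppr_gt0 -(pmulr_lgt0 _ D).
  apply: (sq_gt0 _ (c1 * c2 * (w - t3) * rho w * rho t1 * rho t2)).
  have := mulr_gt0 (mulr_gt0 (mulr_gt0 A1 A2) (mulr_gt0 B1 B2)) r12.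
  by congr (_ < _); ring.
case: (lerP w t1) => wt1.
  move: h12; rewrite ltNge mulr_le0// ?subr_le0//.
  exact: le_trans (ltW t12).
have w1 : 0 < w - t1 by rewrite subr_gt0.
move: h12 h13; rewrite pmulr_rlt0// pmulr_rgt0// subr_lt0 subr_gt0 => w2 w3.
by have := lt_trans w3 (lt_trans w2 t23); rewrite ltxx.
Qed.
End SmallDegree.

(** * Positive bases *)

Section Bases.

Lemma basis_leq (R : realType) (V : lmodType R) (X : set V) n n'
    (e : 'I_n -> V) (e' : 'I_n' -> V) :
  is_basis X e -> is_basis X e' -> (n <= n')%N.
Proof.
move=> [Xe fe ge] [Xe' _ ge'].
have /boolp.choice[A eA] : forall i, exists c : 'I_n' -> R, e i = \sum_j c j *: e' j.
  by move=> i; exact: ge'.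
have /boolp.choice[B eB] : forall i, exists c : 'I_n -> R, e' i = \sum_j c j *: e j.
  by move=> i; exact: ge.
apply: (@mulmx1_min R n n' (\matrix_(i, j) A i j) (\matrix_(i, j) B i j)).
apply/matrixP => i k; rewrite !mxE; apply/eqP; rewrite -subr_eq0; apply/eqP.
under eq_bigr do rewrite !mxE.
apply: (fe (fun k => \sum_j A i j * B j k - (i == k)%:R)).
under eq_bigr do rewrite scalerBl scaler_suml.
rewrite sumrB exchange_big /=.
under eq_bigr do under eq_bigr do rewrite -scalerA.
under eq_bigr do rewrite -scaler_sumr -eB.
rewrite -eA [X in _ - X](bigD1 i) //= eqxx scale1r big1 ?addr0 ?subrr//.
by move=> j ji; rewrite eq_sym (negbTE ji) scale0r.
Qed.

Lemma basis_size (R : realType) (V : lmodType R) (X : set V) n n'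
    (e : 'I_n -> V) (e' : 'I_n' -> V) :
  is_basis X e -> is_basis X e' -> n = n'.
Proof.
by move=> be be'; apply/eqP; rewrite eqn_leq (basis_leq be be') (basis_leq be' be).
Qed.

Variable R : realType.

Lemma horner_near (p : {poly R}) (t e : R) : 0 < e ->
  exists2 d : R, 0 < d & forall x, `|x - t| < d -> `|p.[x] - p.[t]| < e.
Proof.
move=> e0; have := @continuous_horner R p t [set y | `|y - p.[t]| < e].
move=> h; have /nbhs_norm_lt[d d0 dP] : nbhs t (horner p @^-1` [set y | `|y - p.[t]| < e]).
  apply: h; apply/nbhs_ballP; exists e => // y.
  by rewrite -ball_normE /= distrC.
by exists d.
Qed.

(** Otherwise a common power of [X - t] cancels, leaving a cofactor of [q] that is nonzero at [t]
    and a cofactor of [p] that is bounded nearby, so [q] is not small compared with [p]. *)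
Lemma mup_ltn_lim (p q : {poly R}) (t : R) : q != 0 ->
  (forall e d : R, 0 < e -> 0 < d ->
     exists2 x, `|x - t| < d & `|q.[x]| < e * `|p.[x]|) ->
  (mup t p < mup t q)%N.
Proof.
move=> q0 H.
have p0 : p != 0.
  have [x _] := H 1 1 ltr01 ltr01; apply: contraTneq => ->.
  by rewrite horner0 normr0 mulr0 ltNge normr_ge0.
rewrite ltnNge; apply/negP; rewrite mup_geq//; set k := mup t q => /dvdpP[p' pE].
have /dvdpP[q' qE] : ('X - t%:P) ^+ k %| q by rewrite -mup_geq.
have q't : ~~ root q' t.
  apply/negP => /factor_theorem[q'' q'E].
  suff : (k.+1 <= mup t q)%N by rewrite ltnn.
  by rewrite mup_geq// qE q'E -mulrA -exprS dvdp_mull.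
have c0 : 0 < `|q'.[t]| / 2 by rewrite divr_gt0// normr_gt0.
have [d1 d10 d1P] := horner_near q' t c0.
have [d2 d20 d2P] := horner_near p' t ltr01.
pose M := `|p'.[t]| + 1.
have M0 : 0 < M by rewrite ltr_wpDl.
(* This ratio is incompatible with [|q'| >= |q'.[t]| / 2] and [|p'| <= M] near [t]. *)
have [|x] := H (`|q'.[t]| / 2 / M) (Num.min d1 d2) (divr_gt0 c0 M0).
  by rewrite lt_min d10.
rewrite lt_min => /andP[/d1P h1 /d2P h2].
rewrite pE qE !hornerM !normrM mulrA.
set g := `|(('X - t%:P) ^+ k).[x]|; move=> h.
have g0 : 0 < g.
  by rewrite lt_neqAle normr_ge0 andbT eq_sym; apply/eqP => g0; move: h; rewrite g0 !mulr0 ltxx.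
move: h; rewrite ltr_pM2r// => h.
have h3 : `|p'.[x]| <= M.
  rewrite /M -lerBlDl; apply: le_trans (ltW h2); exact: lerB_dist.
have h4 : `|q'.[t]| / 2 <= `|q'.[x]|.
  have := lerB_dist q'.[t] q'.[x]; rewrite distrC in h1.
  by move: h1; set u := `|_ - _|; move=> h1 h5; lra.
have : `|q'.[t]| / 2 < `|q'.[t]| / 2 / M * M.
  by apply: le_lt_trans h4 (lt_le_trans h _); rewrite ler_wpM2l// divr_ge0// ltW.
by rewrite divfK ?gt_eqF// ltxx.
Qed.

Variables (Om : set R) (Om_compact : compact Om) (m : nat).

Lemma pt_of (w : R) : Om w -> exists x : Om, val x = w.
Proof. by move=> Ow; exists (exist _ w (mem_set Ow)). Qed.

Lemma pt_Om (x : Om) : Om (val x).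
Proof. exact: set_valP. Qed.

Lemma positive_basis_peak X n (e : 'I_n -> (Om -> R)) i (eps : R) :
  is_subspace X -> positive_basis X e -> 0 < eps ->
  exists x : Om, \sum_(j | j != i) e j x < eps * e i x.
Proof.
move=> [X0 Xlin] [[Xe fe ge] pe cone] eps0; apply: contrapT => nx.
pose c j : R := if j == i then - eps else 1.
have Xsum : X (\sum_j c j *: e j).
  elim/big_rec: _ => // j f _ Xf; exact: Xlin.
have sumE x : (\sum_j c j *: e j) x = \sum_(j | j != i) e j x - eps * e i x.
  rewrite fct_sumE (bigD1 i)//= addrC; congr (_ + _); last first.
    by rewrite /c eqxx /= -mulNr.
  by apply: eq_bigr => j ji; rewrite /c (negbTE ji) scale1r.
have [|c' c'0 cE] := cone _ Xsum.
  move=> x; rewrite sumE subr_ge0 leNgt; apply/negP => h; apply: nx.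
  by exists x.
have /(_ i) : forall j, c j - c' j = 0.
  apply: fe; under eq_bigr do rewrite scalerBl.
  by rewrite sumrB cE subrr.
rewrite /c eqxx => /eqP; rewrite subr_eq0 => /eqP cE'.
by have := c'0 i; rewrite -cE' oppr_ge0 leNgt eps0.
Qed.

(** At [t i] the polynomial of [e i] vanishes to lower order than all the others. So the [t i] are
    distinct, and [p i] vanishes at every other [t j]. *)
Lemma positive_basis_peaked X n (e : 'I_n -> (Om -> R)) :
  is_subspace X -> X `<=` @poly_space R Om m -> positive_basis X e ->
  exists2 T, peaked Om m T & size T = n.
Proof.
move=> sX Xm pbe; have [[Xe fe ge] pe cone] := pbe.
have /boolp.choice[p pP] : forall i, exists p : {poly R},
    (size p <= m.+1)%N /\ forall x : Om, e i x = p.[val x].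
  by move=> i; have [p] := Xm _ (Xe i); exists p.
have p_ge0 i w : Om w -> 0 <= (p i).[w].
  by move=> /pt_of[x <-]; rewrite -(pP i).2; exact: pe.
have p0 i : p i != 0.
  apply/eqP => pi0; have /fe/(_ i)/eqP : \sum_j (j == i)%:R *: e j = 0.
    rewrite (bigD1 i)//= eqxx scale1r big1 ?addr0.
      by apply/funext => x; rewrite (pP i).2 pi0 horner0.
    by move=> j /negbTE->; rewrite scale0r.
  by rewrite eqxx oner_eq0.
have /boolp.choice[t tP] : forall i, exists t, Om t /\ forall j, j != i ->
    (mup t (p i) < mup t (p j))%N.
  move=> i.
  have /boolp.choice[w wP] : forall k : nat, exists x : R, Om x /\
      forall j, j != i -> (p j).[x] < k.+1%:R^-1 * (p i).[x].
    move=> k; have [|x xP] := @positive_basis_peak X n e i k.+1%:R^-1 sX pbe.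
      by rewrite invr_gt0.
    exists (val x); split; first exact: pt_Om.
    move=> j ji; rewrite -!(pP _).2; apply: le_lt_trans xP.
    by rewrite (bigD1 j)//= lerDl sumr_ge0// => l _; exact: pe.
  have [|t [Ot tcl]] := Om_compact (F := w @ \oo).
    by exists 0%N => // k _; exact: (wP k).1.
  exists t; split => // j ji; apply: mup_ltn_lim => // eps d eps0 d0.
  (* From [N] on, [1 / (k + 1)] is at most [eps]. *)
  pose N := Num.truncn eps^-1.
  have [||_ [[k Nk <-] kd]] := tcl [set w k | k in [set k | (N <= k)%N]] [set x | `|x - t| < d].
  - by exists N => // k /= Nk; exists k.
  - by apply/nbhs_ballP; exists d => // y; rewrite -ball_normE /= distrC.
  exists (w k) => //; rewrite !ger0_norm ?p_ge0 //; try exact: (wP k).1.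
  apply: lt_le_trans ((wP k).2 j ji) _; rewrite ler_wpM2r ?p_ge0 //; first exact: (wP k).1.
  rewrite -[leRHS]invrK lef_pV2 ?posrE ?invr_gt0//.
  by apply: ltW; apply: lt_le_trans (truncnS_gt _) _; rewrite ler_nat ltnS.
exists [seq t i | i : 'I_n]; last by rewrite size_map size_enum_ord.
split.
- rewrite map_inj_in_uniq ?enum_uniq// => i j _ _ tij; apply/eqP.
  apply: contrapT => /negP ij; have := (tP i).2 j; rewrite eq_sym => /(_ ij).
  by rewrite tij ltnNge ltnW// (tP j).2.
- by move=> _ /mapP[i _ ->]; exact: (tP i).1.
- move=> _ /mapP[i _ ->]; exists (p i); split=> //; first exact: (pP i).1.
    by move=> w; exact: p_ge0.
  move=> _ /mapP[j _ ->] tji; rewrite -dvdp_XsubCl XsubC_dvd//.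
  apply: leq_ltn_trans (leq0n _) ((tP j).2 i _).
  by apply: contra tji => /eqP->.
Qed.
End Bases.

(** * Lower bounds *)

Section LowerBounds.
Variables (R : realType) (Om : set R).
Implicit Types (T : seq R) (P Q : {poly R}).

(* [P] bounds the degrees in products of configurations; the polynomials [Q]
   that form the positive basis have degree at most [D - dl]. *)
Definition config T (D dl : nat) : Prop :=
  [/\ uniq T, forall x, x \in T -> Om x,
      exists P, [/\ (size P <= D.+1)%N, forall w, Om w -> 0 <= P.[w]
        & forall w, Om w -> root P w = (w \in T)]
    & forall t, t \in T -> exists Q,
        [/\ (size Q + dl <= D.+1)%N, forall w, Om w -> 0 <= Q.[w], 0 < Q.[t]
          & forall y, y \in T -> y != t -> root Q y]].

Lemma config_nil dl : config [::] 0 dl.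
Proof.
split=> //; exists 1; split=> [|w _|w _]; first by rewrite size_poly1.
  by rewrite hornerC.
by rewrite rootE hornerC oner_eq0.
Qed.

(** For [t] in one part, its [Q] is multiplied by the [P] of the other, which is positive at [t]
    because its zeros in [Om] are exactly the points of the other part. *)
Lemma config_cat T1 T2 D1 D2 dl : config T1 D1 dl -> config T2 D2 dl ->
  (forall x, x \in T1 -> x \notin T2) -> config (T1 ++ T2) (D1 + D2) dl.
Proof.
move=> [u1 O1' [P1 [sP1 P1_ge0 P1E]] Q1P] [u2 O2' [P2 [sP2 P2_ge0 P2E]] Q2P] d12.
have Ppos (P : {poly R}) T w : (forall w, Om w -> 0 <= P.[w]) ->
    (forall w, Om w -> root P w = (w \in T)) -> Om w -> w \notin T -> 0 < P.[w].
  by move=> P0 PE Ow wT; rewrite lt_neqAle P0// andbT eq_sym -[_ == _]/(root P w) PE.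
split.
- rewrite cat_uniq u1 u2 andbT; apply/hasPn => x x2.
  by apply/negP => /d12; rewrite x2.
- by move=> x; rewrite mem_cat => /orP[/O1'|/O2'].
- exists (P1 * P2); split=> [|w Ow|w Ow].
  + by apply: leq_trans (size_polyMleq _ _) _; move: sP1 sP2; clear; lia.
  + by rewrite hornerM mulr_ge0 ?P1_ge0 ?P2_ge0.
  + by rewrite rootM mem_cat P1E ?P2E.
move=> t; rewrite mem_cat => /orP[t1|t2].
  have [Q [sQ Q0 Qt Qy]] := Q1P t t1; exists (Q * P2); split.
  - by apply: leq_trans (leq_add (size_polyMleq _ _) (leqnn _)) _; move: sQ sP2; clear; lia.
  - by move=> w Ow; rewrite hornerM mulr_ge0 ?Q0 ?P2_ge0.
  - rewrite hornerM; apply: mulr_gt0 => //.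
    by apply: (Ppos _ T2) => //; [exact: O1'|exact: d12].
  - move=> y; rewrite mem_cat rootM => /orP[y1 yt|y2 _]; first by rewrite Qy.
    by rewrite (P2E _ (O2' _ y2)) y2 orbT.
have [Q [sQ Q0 Qt Qy]] := Q2P t t2; exists (P1 * Q); split.
- by apply: leq_trans (leq_add (size_polyMleq _ _) (leqnn _)) _; move: sQ sP1; clear; lia.
- by move=> w Ow; rewrite hornerM mulr_ge0 ?Q0 ?P1_ge0.
- rewrite hornerM; apply: mulr_gt0 => //; apply: (Ppos _ T1) => //; first exact: O2'.
  by apply/negP => /d12; rewrite t2.
- move=> y; rewrite mem_cat rootM => /orP[y1 _|y2 yt]; last by rewrite Qy// orbT.
  by rewrite (P1E _ (O1' _ y1)) y1.
Qed.

(** For a single point the constant 1 serves as [Q], so up to the full degree of [P] is saved. *)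
Lemma config1 x P D dl : Om x -> (size P <= D.+1)%N -> (dl <= D)%N ->
  (forall w, Om w -> 0 <= P.[w]) -> (forall w, Om w -> root P w = (w == x)) ->
  config [:: x] D dl.
Proof.
move=> Ox sP Dd P0 PE; split=> //; first by move=> y; rewrite inE => /eqP->.
  by exists P; split=> // w Ow; rewrite inE PE.
move=> t; rewrite inE => /eqP->; exists 1; split.
- by rewrite size_poly1 add1n.
- by move=> w _; rewrite hornerC.
- by rewrite hornerC.
- by move=> y; rewrite inE => /eqP->; rewrite eqxx.
Qed.

Lemma config_min a dl : Om a -> (forall x, Om x -> a <= x) -> (dl <= 1)%N ->
  config [:: a] 1 dl.
Proof.
move=> Oa a_min dl1; apply: (@config1 a ('X - a%:P)) => //.
- by rewrite size_XsubC.
- by move=> w Ow; rewrite hornerXsubC subr_ge0 a_min.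
- by move=> w _; rewrite root_XsubC.
Qed.

Lemma config_max b dl : Om b -> (forall x, Om x -> x <= b) -> (dl <= 1)%N ->
  config [:: b] 1 dl.
Proof.
move=> Ob b_max dl1; apply: (@config1 b (- ('X - b%:P))) => //.
- by rewrite size_polyN size_XsubC.
- by move=> w Ow; rewrite hornerN hornerXsubC opprB subr_ge0 b_max.
- by move=> w _; rewrite rootN root_XsubC.
Qed.

Lemma config_double x dl : Om x -> (dl <= 1)%N -> config [:: x] 2 dl.
Proof.
move=> Ox dl1; apply: (@config1 x (('X - x%:P) ^+ 2)) => //.
- by rewrite size_exp_XsubC.
- exact: leq_trans dl1 _.
- by move=> w Ow; rewrite horner_exp sqr_ge0.
- by move=> w _; rewrite rootE horner_exp hornerXsubC expf_eq0 /= subr_eq0.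
Qed.

(** Once one end is omitted, the zero at the other end is made double, so no degree is saved and
    [dl] is 0. *)
Lemma config_gap u v : gap Om u v -> config [:: u; v] 2 0.
Proof.
move=> [Ou Ov uv nuv]; split.
- by rewrite /= inE andbT lt_eqF.
- by move=> x; rewrite !inE => /orP[]/eqP->.
- exists (('X - u%:P) * ('X - v%:P)); split=> [|w Ow|w _].
  + by rewrite size_Mmonic ?monicXsubC ?polyXsubC_eq0// !size_XsubC.
  + rewrite hornerM !hornerXsubC; case: (leP w u) => wu.
      by rewrite mulr_le0 ?subr_le0// (le_trans wu)// ltW.
    have := nuv _ Ow; rewrite wu /= -leNgt => vw.
    by rewrite mulr_ge0 ?subr_ge0// ltW.
  + by rewrite rootM !root_XsubC !inE.
move=> t; rewrite !inE => /orP[]/eqP->.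
- exists (('X - v%:P) ^+ 2); split=> [||| y].
  + by rewrite size_exp_XsubC.
  + by move=> w Ow; rewrite horner_exp sqr_ge0.
  + by rewrite horner_exp exprn_even_gt0//= hornerXsubC subr_eq0 lt_eqF.
  + by rewrite !inE => /orP[]/eqP->; rewrite ?eqxx// rootE horner_exp hornerXsubC subrr expr0n.
- exists (('X - u%:P) ^+ 2); split=> [||| y].
  + by rewrite size_exp_XsubC.
  + by move=> w Ow; rewrite horner_exp sqr_ge0.
  + by rewrite horner_exp exprn_even_gt0//= hornerXsubC subr_eq0 gt_eqF.
  + by rewrite !inE => /orP[]/eqP->; rewrite ?eqxx// rootE horner_exp hornerXsubC subrr expr0n.
Qed.

Lemma config_matching (l : seq (R * R)) : matching Om l -> config (ends l) (size l).*2 0.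
Proof.
elim: l => [_|e l IH /matching_consE[g /IH cl e1 e2]]; first exact: config_nil.
apply: (@config_cat [:: e.1; e.2] (ends l) 2 (size l).*2 0 _ cl); first exact: config_gap.
by move=> x; rewrite !inE => /orP[]/eqP->.
Qed.

Lemma config_doubles s dl : uniq s -> (forall x, x \in s -> Om x) -> (dl <= 1)%N ->
  config s (size s).*2 dl.
Proof.
move=> us Os dl1; elim: s us Os => [_ _|x s IH /= /andP[xs us] Os]; first exact: config_nil.
apply: (@config_cat [:: x] s 2 (size s).*2) => //.
- by apply: config_double => //; apply: Os; rewrite mem_head.
- by apply: IH => // y ys; apply: Os; rewrite inE ys orbT.
- by move=> y; rewrite inE => /eqP->.
Qed.

Lemma infinite_avoid (s : seq R) q : infinite_set Om -> exists t : seq R,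
  [/\ uniq t, size t = q, forall x, x \in t -> Om x & forall x, x \in t -> x \notin s].
Proof.
move=> iO; elim: q => [|q [t [ut st Ot ts]]]; first by exists [::].
have : infinite_set (Om `\` [set` s ++ t]) by apply: infinite_setD => //; exact: finite_seq.
move=> /infinite_setN0[w [Ow /negP]]; rewrite mem_cat negb_or => /andP[ws wt].
exists (w :: t); split=> //=; rewrite ?wt ?st// => x; rewrite inE => /orP[/eqP->//|].
  exact: Ot.
exact: ts.
Qed.

(** The matrix of the values of the [Q] at the points of [T] is diagonal and positive, so signs of
    coefficients are read off from values. *)
Lemma config_basis T D dl m : config T D dl -> (D <= m + dl)%N ->
  exists2 Y : set (Om -> R), pos_basis_subspace m Y & has_dim Y (size T).
Proof.
move=> [uT TOm _ QP] Dm.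
have nthT (i : 'I_(size T)) : T`_i \in T by rewrite mem_nth.
have /boolp.choice[Q QE] := fun i : 'I_(size T) => QP _ (nthT i).
pose e i : Om -> R := fun x => (Q i).[val x].
have /boolp.choice[pt ptE] := fun i : 'I_(size T) => pt_of (TOm _ (nthT i)).
have eval (c : 'I_(size T) -> R) i :
    (\sum_j c j *: e j) (pt i) = c i * (Q i).[T`_i].
  rewrite fct_sumE (bigD1 i)//= big1 ?addr0; first by rewrite -[LHS]/(c i * (Q i).[val (pt i)]) ptE.
  move=> j ji; rewrite -[LHS]/(c j * (Q j).[val (pt i)]) ptE.
  have [_ _ _ /(_ _ (nthT i))] := QE j; rewrite nth_uniq// eq_sym ji.
  by move=> /(_ isT)/rootP->; rewrite mulr0.
have Qpos i : 0 < (Q i).[T`_i] by have [] := QE i.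
pose Y := [set f | exists c : 'I_(size T) -> R, f = \sum_j c j *: e j].
have bY : is_basis Y e.
  split=> // [i|c c0 i].
    exists (fun j => (j == i)%:R); rewrite (bigD1 i)//= eqxx scale1r big1 ?addr0//.
    by move=> j /negbTE->; rewrite scale0r.
  have := eval c i; rewrite c0 => /esym/eqP; rewrite mulf_eq0 (gt_eqF (Qpos i)) orbF.
  by move/eqP.
exists Y; last by exists e.
split.
- split; first by exists (fun=> 0); under eq_bigr do rewrite scale0r; rewrite big1.
  move=> k _ _ [c ->] [c' ->]; exists (fun j => k * c j + c' j).
  rewrite scaler_sumr -big_split /=; apply: eq_bigr => j _.
  by rewrite scalerDl scalerA.
- move=> _ [c ->]; exists (\sum_j c j *: Q j).
    apply: (leq_trans (size_sum _ _ _)); apply/bigmax_leqP => j _.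
    apply: (leq_trans (size_scale_leq _ _)).
    by have [sQ _ _ _] := QE j; move: sQ Dm; clear; lia.
  by move=> x; rewrite fct_sumE horner_sum; apply: eq_bigr => j _; rewrite hornerZ.
exists (size T), e; split=> // [i x|_ [c ->] pc].
  by have [_ Q0 _ _] := QE i; apply: Q0; exact: pt_Om.
exists c => // i; have := pc (pt i); rewrite eval.
by rewrite pmulr_lge0.
Qed.

(** Each extreme point costs one degree, each of the [q] other new points two. *)
Lemma config_extend T D dl (a b : R) (al be : bool) q m :
    infinite_set Om -> Om a -> (forall x, Om x -> a <= x) ->
    Om b -> (forall x, Om x -> x <= b) -> config T D dl -> (dl <= 1)%N ->
    (al -> a \notin T) -> (be -> b \notin T) -> (D + al + be + q.*2 <= m + dl)%N ->
  exists2 Y : set (Om -> R), pos_basis_subspace m Y & has_dim Y (size T + al + be + q).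
Proof.
move=> iO aOm a_min bOm b_max cT dl1 aT bT Dm.
have ab : a != b.
  apply/eqP => ab; have [t [_ st Ot ts]] := infinite_avoid [:: a] 1 iO.
  case: t st Ot ts => // w t _ Ot ts.
  have Ow : Om w by apply: Ot; rewrite mem_head.
  have := ts w; rewrite mem_head inE => /(_ isT)/negP; apply.
  by rewrite eq_le [w <= a](_ : _ = true) ?a_min// ab b_max.
pose Ta := if al then a :: T else T.
have cTa : config Ta (D + al) dl.
  rewrite /Ta; case: al aT {Ta Dm} => aT; last by rewrite addn0.
  rewrite addnC; apply: (@config_cat [:: a]) => //; first exact: config_min.
  by move=> x; rewrite inE => /eqP->; exact: aT.
pose Tb := if be then b :: Ta else Ta.
have cTb : config Tb (D + al + be) dl.
  rewrite /Tb; case: be bT {Tb Dm} => bT; last by rewrite addn0.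
  rewrite [X in config _ X _]addnC; apply: (@config_cat [:: b]) => //; first exact: config_max.
  move=> x; rewrite inE => /eqP->; rewrite /Ta; case: (al); rewrite ?inE ?bT//.
  by rewrite eq_sym (negbTE ab) /= bT.
have [t [ut st Ot ts]] := infinite_avoid Tb q iO.
have cTt : config (t ++ Tb) ((size t).*2 + (D + al + be)) dl.
  by apply: config_cat => //; exact: config_doubles.
have [|Y pY dY] := config_basis (m := m) cTt; first by rewrite st addnC.
exists Y => //; suff <- : size (t ++ Tb) = (size T + al + be + q)%N by [].
by rewrite size_cat st /Tb /Ta; case: (al); case: (be) => /=; clear; lia.
Qed.

(** At most one gap of a matching has [a] as an end; it is dropped. *)
Lemma matching_avoid (l : seq (R * R)) (a : R) : matching Om l ->
  exists l' : seq (R * R), [/\ matching Om l', a \notin ends l' & (size l <= (size l').+1)%N].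
Proof.
elim: l => [ml|e l IH me]; first by exists [::]; split.
have /matching_consE[ge ml e1 e2] := me.
have [ae|ae] := boolP ((a == e.1) || (a == e.2)).
  by exists l; split=> //; case/orP: ae => /eqP->.
suff [l' [sl al sz]] : exists l' : seq (R * R), [/\ subseq l' l, a \notin ends l' & (size l <= (size l').+1)%N].
  exists (e :: l'); split=> //; first by apply: subseq_matching me; rewrite /= eqxx.
  by rewrite -[ends _]/(e.1 :: e.2 :: ends l') !inE orbA negb_or ae.
have [_ ul] := ml; elim: l ul {IH me ml e1 e2} => [_|x l IH]; first by exists [::].
rewrite -[ends _]/(x.1 :: x.2 :: ends l) /= !inE negb_or => /and3P[/andP[_ x1] x2 ul].
have [ax|ax] := boolP ((a == x.1) || (a == x.2)).
  by exists l; split; [exact: subseq_cons|case/orP: ax => /eqP->|].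
have [l' [sl al sz]] := IH ul.
exists (x :: l'); split=> //=; first by rewrite eqxx.
by rewrite -[ends _]/(x.1 :: x.2 :: ends l') !inE orbA negb_or ax.
Qed.
End LowerBounds.

(** * The maximal dimension, case by case *)

Section MaximalDimension.
Variables (R : realType) (Om : set R) (m d : nat).
Hypotheses (Om_compact : compact Om) (Om_infinite : infinite_set Om).
Hypothesis d_peaked : exists2 T, peaked Om m T & size T = d.
Hypothesis d_maximal : forall (Y : set (Om -> R)) (d' : nat),
  pos_basis_subspace m Y -> has_dim Y d' -> (d' <= d)%N.
Variables (a b : R).
Hypotheses (aOm : Om a) (a_min : forall x, Om x -> a <= x).
Hypotheses (bOm : Om b) (b_max : forall x, Om x -> x <= b).

Let lower T D dl (al be : bool) (q : nat) : config Om T D dl -> (dl <= 1)%N ->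
    (al -> a \notin T) -> (be -> b \notin T) ->
    (D + nat_of_bool al + nat_of_bool be + q.*2 <= m + dl)%N ->
  (size T + al + be + q <= d)%N.
Proof.
move=> cT dl1 aT bT Dm.
have [Y pY] := config_extend Om_infinite aOm a_min bOm b_max cT dl1 aT bT Dm.
exact: d_maximal.
Qed.

Let upper : (1 < m)%N -> (d <= m)%N.
Proof. by move=> m1; have [T pT <-] := d_peaked; exact: peaked_size pT. Qed.

(** Gaps give two points for two degrees. For odd [m] the last degree is spent on [a], after
    dropping a gap that may use it. *)
Lemma dim_many_holes : (1 < m)%N -> has_matching Om (uphalf m) -> d = m.
Proof.
move=> m1 [l ml sl]; apply/eqP; rewrite eqn_leq upper//=.
have mE := odd_double_half m.
have [om|om] := boolP (odd m); last first.
  have := lower (al := false) (be := false) (q := 0) (config_matching ml) isT.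
  rewrite size_ends sl uphalf_half (negbTE om) !addn0 add0n => low.
  have {}low : (m./2.*2 <= d)%N.
    by apply: low => //; move: mE; clear; case: (odd m) => /=; lia.
  by move: mE low; rewrite (negbTE om); clear; lia.
have [l' [ml' al' sl']] := matching_avoid a ml.
have mt := subseq_matching (take_subseq l' m./2) ml'.
have st : size (take m./2 l') = m./2.
  rewrite size_takel//; move: sl'; rewrite sl uphalf_half om; clear; lia.
have := lower (al := true) (be := false) (q := 0) (config_matching mt) isT.
rewrite size_ends st !addn0 addn1 => low.
have {}low : (m./2.*2.+1 <= d)%N.
  apply: low => // [_|].
    apply: contra al' => /endsP[e /mem_take el ae].
    by apply/endsP; exists e.
  by move: mE; rewrite om; clear; lia.
by move: mE low; rewrite om; clear; lia.
Qed.

(** A largest matching is chosen that avoids [a] and [b] where the parities allow it. The avoided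
    extreme points cost one degree each, and double zeros use up the rest. *)
Lemma dim_few_holes r : has_matching Om r -> ~ has_matching Om r.+1 -> (0 < r)%N ->
    (r.*2 < m)%N ->
  d = ((m - Theta_l Om - Theta_r Om) %/ 2 + 1 + r)%N.
Proof.
move=> [l0 ml0 sl0] nr r0 rm.
have Tl1 : (Theta_l Om <= 1)%N by exact: leq_b1.
have Tr1 : (Theta_r Om <= 1)%N by exact: leq_b1.
have [T pT sT] := d_peaked.
have := peaked_holes Om_compact Om_infinite aOm a_min bOm b_max nr r0 pT.
rewrite sT => up.
have [l [ml sl al bl]] : exists l : seq (R * R), [/\ matching Om l, size l = r,
    Theta_l Om = 0%N -> a \notin ends l & Theta_r Om = 0%N -> b \notin ends l].
  have [l1 [ml1 sl1 al1]] : exists l : seq (R * R), [/\ matching Om l, (r <= size l)%N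
      & Theta_l Om = 0%N -> a \notin ends l].
    have [T0|T0] := eqVneq (Theta_l Om) 0%N; last by exists l0; rewrite sl0; split=> // /eqP; rewrite (negbTE T0).
    have [l' [? ? ? _]] := left_avoid Om_compact Om_infinite aOm a_min b_max nr T0 ml0.
    by exists l'; rewrite -sl0; split.
  have le_r := no_matching_size nr.
  have [T0|T0] := eqVneq (Theta_r Om) 0%N; last first.
    exists l1; split=> //; first by apply/eqP; rewrite eqn_leq sl1 le_r.
    by move/eqP; rewrite (negbTE T0).
  have [l' [ml' sl' bl' al']] := right_avoid Om_compact Om_infinite a_min bOm b_max nr T0 ml1.
  exists l'; split=> //; first by apply/eqP; rewrite eqn_leq le_r// (leq_trans sl1).
  by move=> /al1/al'.
pose al0 := Theta_l Om == 0%N.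
(* [b] is added only if a degree is left for it, which fails when [m = 2 r + 1] and [a] has been
   added. *)
pose be0 := (Theta_r Om == 0%N) && (r.*2 + al0 < m)%N.
have := lower (al := al0) (be := be0) (q := (m - r.*2 - al0 - be0)./2)
  (config_matching ml) isT (fun h => al (eqP h)).
have be0b : be0 -> b \notin ends l by move=> /andP[/eqP/bl].
rewrite size_ends sl => /(_ be0b); clear be0b; rewrite /be0 /al0 {be0 al0}.
move: up r0 Tl1 Tr1 rm; move: (Theta_l Om) (Theta_r Om) => p q; clear.
case: p => [|[|//]]; case: q => [|[|//]] /= up r0 _ _ rm;
  rewrite ?eqxx /= ?addn0 ?addn1 ?subn0 ?subn1 -?divn2.
- case: (ltnP r.*2.+1 m) => hm; rewrite ?addn0 ?addn1 ?subn0 ?subn1 => low.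
    have h : (r.*2.+2 + ((m - r.*2).-2 %/ 2).*2 <= m)%N by lia.
    by have := low h; lia.
  have h : (r.*2.+1 + ((m - r.*2).-1 %/ 2).*2 <= m)%N by lia.
  by have := low h; lia.
- move=> low.
  have h : (r.*2.+1 + ((m - r.*2).-1 %/ 2).*2 <= m)%N by lia.
  by have := low h; lia.
- rewrite rm /= ?addn0 ?addn1 ?subn0 ?subn1 => low.
  have h : (r.*2.+1 + ((m - r.*2).-1 %/ 2).*2 <= m)%N by lia.
  by have := low h; lia.
- move=> low.
  have h : (r.*2 + ((m - r.*2) %/ 2).*2 <= m)%N by lia.
  by have := low h; lia.
Qed.

(** Every factor belongs to a single point, so omitting a point saves a degree: [dl] is 1 and the
    total degree may be [m + 1]. Parity decides whether [b] is added. *)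
Lemma dim_no_hole : ~ has_matching Om 1 -> d = ((m + 3) %/ 2)%N.
Proof.
move=> n1; have [T pT sT] := d_peaked.
have := peaked_no_hole aOm a_min bOm b_max n1 pT; rewrite sT => up.
have := lower (al := true) (be := odd m) (q := m./2) (config_nil Om 1) isT.
have := odd_double_half m; move: up; clear.
case: (odd m) => /= up mE /(_ (fun _ => isT) (fun _ => isT)) low.
  have h : (0 + 1 + 1 + m./2.*2 <= m + 1)%N by lia.
  by have := low h; lia.
have h : (0 + 1 + 0 + m./2.*2 <= m + 1)%N by lia.
by have := low h; lia.
Qed.
End MaximalDimension.

(** The guards [1 < m] are there because the constants for [m = 0], and the span of [x - min Omega]
    and [max Omega - x] for [m = 1], have dimension [m + 1]. In the third case [4 <= m], so the
    truncated subtractions are exact. *)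
Theorem theorem12 (R : realType) (Omega : set R)
    (Omega_compact : compact Omega) (Omega_infinite : infinite_set Omega)
    (m : nat) (X : set (Omega -> R)) (d : nat)
    (X_pos_basis : pos_basis_subspace m X)
    (X_dim : has_dim X d)
    (X_maximal : forall (Y : set (Omega -> R)) (d' : nat),
       pos_basis_subspace m Y -> has_dim Y d' -> (d' <= d)%N) :
  [/\ (1 < m)%N -> ((m%:R / 2)%:E <= lambda Omega)%E ->
        d = m,
      (1 < m)%N -> (((m%:R - 1) / 2)%:E = lambda Omega)%E ->
        d = (m - Theta_l Omega * Theta_r Omega)%N,
      (lambda Omega <= ((m%:R - 2) / 2)%:E)%E -> (1 <= lambda Omega)%E ->
        ((d%:R)%:E =
          ((m - Theta_l Omega - Theta_r Omega) %/ 2 + 1)%N%:R%:E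
            + lambda Omega)%E
    & lambda Omega = 0%E ->
        d = ((m + 3) %/ 2)%N].
Proof.
have [sX Xm [n [e pbe]]] := X_pos_basis.
have d_peaked : exists2 T, peaked Omega m T & size T = d.
  have [T pT sT] := positive_basis_peaked Omega_compact sX Xm pbe.
  exists T => //; rewrite sT.
  by have [e' be'] := X_dim; have [be _ _] := pbe; exact: basis_size be be'.
have [a [b [aOm bOm a_min b_max]]] :=
  compact_bounds Omega_compact (infinite_setN0 Omega_infinite).
have many := dim_many_holes Omega_infinite d_peaked X_maximal aOm a_min bOm b_max.
have few := dim_few_holes Omega_compact Omega_infinite d_peaked X_maximal aOm a_min bOm b_max.
have none := dim_no_hole Omega_infinite d_peaked X_maximal aOm a_min bOm b_max.
have Tl1 : (Theta_l Omega <= 1)%N by exact: leq_b1.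
have Tr1 : (Theta_r Omega <= 1)%N by exact: leq_b1.
have cO : closed Omega := compact_closed (@norm_hausdorff _ _) Omega_compact.
(* For infinite [lambda] only the first case can occur. *)
have [[-> all_m]|[r [-> mr nr]]] := lambdaP cO; first by split=> // m1 _; exact: many.
split=> [m1|m1||].
- rewrite lee_fin ler_pdivrMr// -natrM ler_nat => mr2; apply: many => //.
  by apply: has_matching_le mr; rewrite leq_uphalf_double -muln2.
(* Here [m = 2 r + 1] with [0 < r], and the formula for few holes specializes to
   [m - Theta_l * Theta_r]. *)
- move=> [mE].
  have {}mE : m = r.*2.+1.
    apply/eqP; rewrite -(eqr_nat R) -addn1 -muln2 natrD natrM; apply/eqP; lra.
  rewrite (few r) ?mE//; last by move: m1; rewrite mE; clear; lia.
  move: Tl1 Tr1; move: (Theta_l _) (Theta_r _) => p q; rewrite -mE in m1 *; clear -mE m1.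
  by case: p => [|[|//]]; case: q => [|[|//]] _ _ /=; rewrite ?muln0 ?muln1; lia.
- rewrite !lee_fin => rm r1; rewrite -EFinD -natrD; congr (_%:R%:E); apply: few => //.
    by move: r1; rewrite ler1n.
  have : (r.*2 + 2 <= m)%N.
    rewrite -(ler_nat R) natrD -muln2 natrM; lra.
  by clear; lia.
- move=> [r0]; apply: none.
  by move: nr; have /eqP -> : r == 0%N by rewrite -(eqr_nat R) r0.
Qed.
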